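(* There exists a function $\beta:\mathbb{N}\to\mathbb{N}$ such that for every positive integer $n$, every integral polyhedron $P\subseteq\mathbb{R}^n$ containing an integer point in its relative interior, and every relaxation $Q$ of $P$, the $\beta(n)$-th Chvátal–Gomory closure $Q^{(\beta(n))}$ is contained in the affine hull $\operatorname{aff}(P)$.
   Context: For a polyhedron $Q\subseteq\mathbb{R}^n$, its integer hull is $Q_I:=\operatorname{conv}(Q\cap\mathbb{Z}^n)$; $Q$ is integral if $Q=Q_I$. Given an integral polyhedron $P\subseteq\mathbb{R}^n$, a relaxation of $P$ is a rational polyhedron $Q\subseteq\mathbb{R}^n$ with $Q\cap\mathbb{Z}^n=P\cap\mathbb{Z}^n$. An inequality $cx\le\lfloor\delta\rfloor$ is a Chvátal–Gomory (CG) inequality for $Q$ if $c\in\mathbb{Z}^n$ and $cx\le\delta$ is valid for $Q$. The CG closure $Q'$ is the set of points of $Q$ satisfying all CG inequalities for $Q$; $Q^{(0)}:=Q$ and $Q^{(k)}:=(Q^{(k-1)})'$. $\operatorname{aff}(S)$ denotes the smallest affine set containing $S$. *)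

(* Defs.v *)
From mathcomp Require Import all_boot all_order all_algebra.
From mathcomp Require Import reals.
Set Implicit Arguments. Unset Strict Implicit. Unset Printing Implicit Defensive.
Import Order.TTheory GRing.Theory Num.Theory.
Local Open Scope ring_scope.

Section Polyhedra.
Variables (R : realType) (n : nat).

Definition pset := 'rV[R]_n -> Prop.

Definition dotv (c x : 'rV[R]_n) : R := \sum_(i < n) c 0 i * x 0 i.

Definition int_vec (x : 'rV[R]_n) : Prop := forall i, x 0 i \is a Num.int.

Definition polyhedron (P : pset) : Prop :=
  exists (m : nat) (A : 'M[R]_(m, n)) (b : 'cV[R]_m),
    forall x, P x <-> (forall j, dotv (row j A) x <= b j 0).

Definition rational_polyhedron (P : pset) : Prop :=
  exists (m : nat) (A : 'M[rat]_(m, n)) (b : 'cV[rat]_m),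
    forall x, P x <-> (forall j, dotv (row j (map_mx ratr A)) x <= ratr (b j 0)).

Definition conv (S : pset) : pset := fun x =>
  exists (k : nat) (w : 'I_k -> R) (p : 'I_k -> 'rV[R]_n),
    (forall i, 0 <= w i) /\ \sum_(i < k) w i = 1 /\ (forall i, S (p i)) /\
    x = \sum_(i < k) w i *: p i.

Definition int_hull (Q : pset) : pset := conv (fun x => Q x /\ int_vec x).

Definition integral_polyhedron (P : pset) : Prop :=
  polyhedron P /\ (forall x, P x <-> int_hull P x).

Definition relaxation (P Q : pset) : Prop :=
  rational_polyhedron Q /\
  (forall x, int_vec x -> (Q x <-> P x)).

Definition cg_closure (Q : pset) : pset := fun x =>
  Q x /\ forall (c : 'rV[R]_n) (delta : R), int_vec c ->
    (forall y, Q y -> dotv c y <= delta) ->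
    dotv c x <= (Num.floor delta)%:~R.

Definition cg_iter (k : nat) (Q : pset) : pset := iter k cg_closure Q.

Definition affine_set (A : pset) : Prop :=
  forall x y (t : R), A x -> A y -> A ((1 - t) *: x + t *: y).

Definition aff (S : pset) : pset := fun x =>
  forall A, affine_set A -> (forall y, S y -> A y) -> A x.

Definition relint (S : pset) : pset := fun x =>
  S x /\ exists eps : R, 0 < eps /\
    forall y, aff S y -> (forall i, `|y 0 i - x 0 i| < eps) -> S y.

End Polyhedra.

(* Main.v *)
(* Flatness: if every nonzero integer vector has large width on a rational
   polyhedron [K], then [K] contains integer points outside any given hyperplane.
   One slices [K] in the middle along an almost minimal width direction [c].  A
   slice that is thin in a direction [d] would make [K] thin in some [d + t c],
   with [t] integer, contradicting minimality; so all widths of the slice are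
   large and induction on the dimension applies.  Unbounded polyhedra are first
   projected along an integer recession direction.

   Let [0] be an integer point in the relative interior of [P], and let [Q] be a
   relaxation with [aff P] not the whole space.  Flatness gives a direction [c]
   in which [Q] is thin; slicing along [c] when [c] is not orthogonal to [aff P],
   one obtains by induction an integer direction orthogonal to [aff P] in which
   [Q] is thin.  Its nonzero layers contain no integer point, so a bounded number
   of closures cuts them off one after the other, and [Q] shrinks into the
   hyperplane [c x = 0], where induction applies again.  That the rank of a face
   does not exceed that of the polyhedron rests on the closure being again given
   by finitely many integer vectors. *)
Require Import Defs.
From mathcomp Require Import all_boot all_order all_algebra.
From mathcomp Require Import boolp classical_sets reals.
From mathcomp Require Import ring lra.
Set Implicit Arguments. Unset Strict Implicit. Unset Printing Implicit Defensive.
Import Order.TTheory GRing.Theory Num.Theory.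
Local Open Scope ring_scope.

(** * Dual unimodular bases *)
Section Dot.
Variables (F : comPzRingType) (n : nat).
Implicit Types (c d x y : 'rV[F]_n) (a : F).

Definition dot c x : F := \sum_(i < n) c 0 i * x 0 i.

Lemma dotE c x : dot c x = (x *m c^T) 0 0.
Proof. by rewrite mxE; apply: eq_bigr => i _; rewrite mxE mulrC. Qed.

Lemma dotC c x : dot c x = dot x c.
Proof. by apply: eq_bigr => i _; rewrite mulrC. Qed.

Lemma dotDr c x y : dot c (x + y) = dot c x + dot c y.
Proof. by rewrite !dotE mulmxDl mxE. Qed.

Lemma dotNr c x : dot c (- x) = - dot c x.
Proof. by rewrite !dotE mulNmx mxE. Qed.

Lemma dotBr c x y : dot c (x - y) = dot c x - dot c y.
Proof. by rewrite dotDr dotNr. Qed.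

Lemma dotZr c a x : dot c (a *: x) = a * dot c x.
Proof. by rewrite !dotE -scalemxAl mxE. Qed.

Lemma dotDl c d x : dot (c + d) x = dot c x + dot d x.
Proof. by rewrite dotC dotDr !(dotC x). Qed.

Lemma dotNl c x : dot (- c) x = - dot c x.
Proof. by rewrite dotC dotNr dotC. Qed.

Lemma dotBl c d x : dot (c - d) x = dot c x - dot d x.
Proof. by rewrite dotDl dotNl. Qed.

Lemma dotZl a c x : dot (a *: c) x = a * dot c x.
Proof. by rewrite dotC dotZr dotC. Qed.

Lemma dot0l x : dot 0 x = 0.
Proof. by rewrite dotE trmx0 mulmx0 mxE. Qed.

Lemma dot0r c : dot c 0 = 0.
Proof. by rewrite dotC dot0l. Qed.

Lemma dot_suml (I : finType) (P : pred I) (f : I -> 'rV[F]_n) x :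
  dot (\sum_(i | P i) f i) x = \sum_(i | P i) dot (f i) x.
Proof.
by elim/big_rec2: _ => [|i y z _ <-]; rewrite ?dot0l ?dotDl.
Qed.

Lemma dot_delta i x : dot (delta_mx 0 i) x = x 0 i.
Proof.
rewrite /dot (bigD1 i) //= !mxE !eqxx mul1r big1 ?addr0 // => j /negbTE ji.
by rewrite mxE ji andbF mul0r.
Qed.

End Dot.

Definition dotZDE := (dotDl, dotDr, dotBl, dotBr, dotNl, dotNr, dotZl, dotZr, dot0l, dot0r).

Lemma dot_mulmxr (F : comPzRingType) (m n : nat) (c : 'rV[F]_n) (y : 'rV[F]_m)
  (N : 'M[F]_(m, n)) : dot c (y *m N) = dot (c *m N^T) y.
Proof. by rewrite !dotE trmx_mul trmxK mulmxA. Qed.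

Lemma dot_map (F G : comPzRingType) (f : {rmorphism F -> G}) n (c x : 'rV[F]_n) :
  dot (map_mx f c) (map_mx f x) = f (dot c x).
Proof. by rewrite rmorph_sum; apply: eq_bigr => i _; rewrite !mxE rmorphM. Qed.

Section Frame.
Variables (F : comPzRingType) (n : nat).
Implicit Types (c u : 'rV[F]_n.+1) (N : 'M[F]_(n, n.+1)) (M : 'M[F]_(n.+1, n)).

(* The square matrices [u; N] and [c^T M] are inverse to each other. *)
Definition frame c u N M :=
  [/\ dot c u = 1, N *m c^T = 0, u *m M = 0, N *m M = 1%:M
    & c^T *m u + M *m N = 1%:M].

(** Adapted coordinates: [j] is the value of [c] at the point and [y] its position within that
    layer. For an integer frame, each integer layer becomes a copy of the integer lattice one
    dimension lower. *)
Definition pt u N (j : F) (y : 'rV[F]_n) : 'rV[F]_n.+1 := j *: u + y *m N.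

Lemma frame_tr c u N M : frame c u N M -> frame u c M^T N^T.
Proof.
case=> cu Nc uM NM E; split.
- by rewrite dotC.
- by rewrite -trmx_mul uM trmx0.
- by rewrite -[c]trmxK -trmx_mul Nc trmx0.
- by rewrite -trmx_mul NM trmx1.
- by rewrite -[c]trmxK -!trmx_mul -linearD /= E trmx1.
Qed.

Lemma frame_opp c u N M : frame c u N M -> frame (- c) (- u) N M.
Proof.
case=> cu Nc uM NM E; split=> //.
- by rewrite dotNl dotNr opprK.
- by rewrite raddfN /= mulmxN Nc oppr0.
- by rewrite mulNmx uM oppr0.
- by rewrite mulmxN raddfN /= mulNmx opprK.
Qed.

Variables (c u : 'rV[F]_n.+1) (N : 'M[F]_(n, n.+1)) (M : 'M[F]_(n.+1, n)).
Hypothesis cuNM : frame c u N M.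

Lemma frame_dot_pt j y : dot c (pt u N j y) = j.
Proof.
case: cuNM => cu Nc _ _ _; rewrite dotDr dotZr cu mulr1 dotE -mulmxA Nc.
by rewrite mulmx0 mxE addr0.
Qed.

Lemma frame_pt_proj j y : pt u N j y *m M = y.
Proof.
by case: cuNM => _ _ uM NM _; rewrite mulmxDl -scalemxAl uM scaler0 add0r -mulmxA NM mulmx1.
Qed.

Lemma frame_ptK x : pt u N (dot c x) (x *m M) = x.
Proof.
case: cuNM => _ _ _ _ E; rewrite -[RHS]mulmx1 -E mulmxDr !mulmxA; congr (_ + _).
by rewrite [x *m c^T]mx11_scalar mul_scalar_mx -dotE.
Qed.

Lemma frame_dot_lift d j y : dot (d *m M^T) (pt u N j y) = dot d y.
Proof. by rewrite -dot_mulmxr frame_pt_proj. Qed.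

End Frame.

Lemma frame_map (F G : comPzRingType) (f : {rmorphism F -> G}) n (c u : 'rV[F]_n.+1) N M :
  frame c u N M -> frame (map_mx f c) (map_mx f u) (map_mx f N) (map_mx f M).
Proof.
case=> cu Nc uM NM E; split.
- by rewrite dot_map cu rmorph1.
- by rewrite map_trmx -map_mxM Nc map_mx0.
- by rewrite -map_mxM uM map_mx0.
- by rewrite -map_mxM NM map_mx1.
- by rewrite map_trmx -!map_mxM -map_mxD E map_mx1.
Qed.

(** The Smith normal form of the one-row matrix [v] writes it as [e] times the first row of a
    unimodular [G]. The other rows of [G] and the blocks of its inverse complete the frame, and the
    sign of [e] is moved into [c] and [u]. *)
Lemma frame_exists n (v : 'rV[int]_n.+1) : v != 0 ->
  exists g c u N M, [/\ 0 < g :> int, v = g *: c & frame c u N M].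
Proof.
move=> v0; have [L uL [G uG [d _ E]]] := int_Smith_normal_form v.
have frameG s : s * s = 1 -> exists u N M, frame (s *: row 0 G) u N M.
  move=> ss; pose V := invmx G.
  have GV : G *m V = 1%:M by rewrite mulmxV.
  have VG : V *m G = 1%:M by rewrite mulVmx.
  pose c : 'rV_(1 + n) := usubmx (G : 'M_(1 + n, 1 + n)).
  have -> : row 0 G = c.
    apply/rowP=> j; rewrite !mxE; congr (G _ _); exact/val_inj.
  pose u : 'cV_(1 + n) := lsubmx (V : 'M_(1 + n, 1 + n)).
  pose N : 'M_(1 + n, n) := rsubmx (V : 'M_(1 + n, 1 + n)).
  pose M : 'M_(n, 1 + n) := dsubmx (G : 'M_(1 + n, 1 + n)).
  have : col_mx c M *m row_mx u N = 1%:M by rewrite vsubmxK hsubmxK.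
  have : row_mx u N *m col_mx c M = 1%:M by rewrite vsubmxK hsubmxK.
  rewrite mul_row_col mul_col_row => E1.
  rewrite (scalar_mx_block 1 n 1) => /eq_block_mx[cu cN Mu MN].
  exists (s *: u^T), N^T, M^T; split.
  - by rewrite dotZl dotZr mulrA ss mul1r dotC dotE trmxK cu !mxE.
  - by rewrite linearZ /= -scalemxAr -trmx_mul cN trmx0 scaler0.
  - by rewrite -scalemxAl -trmx_mul Mu trmx0 scaler0.
  - by rewrite -trmx_mul MN trmx1.
  - rewrite -scalemxAr linearZ /= -scalemxAl scalerA ss scale1r -!trmx_mul.
    by rewrite -linearD /= E1 trmx1.
pose e := L 0 0 * d`_0.
have vE : v = e *: row 0 G.
  rewrite E [L]mx11_scalar -mulmxA mul_scalar_mx /e -scalerA; congr (_ *: _).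
  apply/rowP=> j; rewrite mxE (bigD1 0) //= big1 => [|k k0].
    by rewrite !mxE /= addr0.
  by rewrite !mxE /= eq_sym (negbTE k0 : (k == 0 :> nat) = false) mul0r.
have e0 : e != 0 by apply: contraNneq v0 => e0; rewrite vE e0 scale0r.
have [|u [N [M fr]]] := frameG (Num.sg e).
  by rewrite -expr2 sqr_sg e0.
exists `|e|, (Num.sg e *: row 0 G), u, N, M; split => //; first by rewrite normr_gt0.
by rewrite scalerA mulrC -numEsg.
Qed.

(** * Farkas' lemma *)
(* Bartl's argument: a vector [x0] separating [c] from the first [m] generators
   but not from the last one serves to eliminate the last generator. *)
Lemma farkas_nat (F : realFieldType) n m (a : nat -> 'rV[F]_n) (c : 'rV[F]_n) :
  (exists y : nat -> F, (forall i, 0 <= y i) /\ c = \sum_(i < m) y i *: a i) \/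
  (exists x, (forall i, (i < m)%N -> dot (a i) x <= 0) /\ 0 < dot c x).
Proof.
elim: m a c => [|m IH] a c.
  have [->|c0] := eqVneq c 0.
    by left; exists (fun=> 0); rewrite big_ord0.
  right; exists c; split => //; rewrite lt_def; apply/andP; split; last first.
    by apply: sumr_ge0 => i _; rewrite -expr2 sqr_ge0.
  apply: contraNneq c0 => /eqP; rewrite psumr_eq0 => [/allP c0|i _]; last first.
    by rewrite -expr2 sqr_ge0.
  apply/eqP/rowP => i; rewrite mxE; apply/eqP.
  by have := c0 i (mem_index_enum _); rewrite mulf_eq0 orbb.
have [[y [y0 ->]]|[x [ax cx]]] := IH a c.
  left; exists (fun i => if (i < m)%N then y i else 0); split.
    by move=> i; case: ifP.
  rewrite big_ord_recr /= ltnn scale0r addr0.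
  by apply: eq_bigr => i _; rewrite ltn_ord.
have [amx|amx] := leP (dot (a m) x) 0.
  right; exists x; split => // i; rewrite ltnS leq_eqVlt => /predU1P[->//|].
  exact: ax.
pose x0 := (dot (a m) x)^-1 *: x.
have amx0 : dot (a m) x0 = 1 by rewrite dotZr mulVf ?gt_eqF.
have ax0 i : (i < m)%N -> dot (a i) x0 <= 0.
  by move=> im; rewrite dotZr pmulr_rle0 ?invr_gt0 // ax.
have cx0 : 0 < dot c x0 by rewrite dotZr pmulr_rgt0 ?invr_gt0.
(* Projection along [a m] onto the hyperplane of vectors orthogonal to [x0]. *)
pose a' i := a i - dot (a i) x0 *: a m.
have [[y [y0 cE]]|[r [ar cr]]] := IH a' (c - dot c x0 *: a m).
  pose t := dot c x0 - \sum_(i < m) y i * dot (a i) x0.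
  left; exists (fun i => if i == m then t else y i); split => [i|].
    case: ifP => // _; rewrite subr_ge0 (le_trans _ (ltW cx0)) //.
    by apply: sumr_le0 => j _; rewrite mulr_ge0_le0 // ax0.
  rewrite big_ord_recr /= eqxx scalerBl [(\sum_(i < m) _) *: _]scaler_suml.
  transitivity (c - dot c x0 *: a m + dot c x0 *: a m); first by rewrite subrK.
  rewrite cE (eq_bigr (fun i : 'I_m => y i *: a i - (y i * dot (a i) x0) *: a m)).
    rewrite sumrB -addrA [- _ + _]addrC; congr (_ + _).
    by apply: eq_bigr => i _; rewrite (ltn_eqF (ltn_ord i)).
  by move=> i _; rewrite /a' scalerBr scalerA.
right; exists (r - dot (a m) r *: x0); split => [i|].
  rewrite ltnS leq_eqVlt => /predU1P[->|/ar].
    by rewrite dotBr dotZr amx0 mulr1 subrr.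
  by rewrite !dotZDE mulrC.
by move: cr; rewrite !dotZDE mulrC.
Qed.

Lemma farkas (F : realFieldType) n (I : finType) (a : I -> 'rV[F]_n) (c : 'rV[F]_n) :
  (exists y : I -> F, (forall i, 0 <= y i) /\ c = \sum_i y i *: a i) \/
  (exists x, (forall i, dot (a i) x <= 0) /\ 0 < dot c x).
Proof.
pose a' := nth 0 (codom a).
have a'E i : a' (enum_rank i) = a i by rewrite /a' nth_codom enum_rankK.
have sumE (G : nat -> 'rV[F]_n) : \sum_(k < #|I|) G k = \sum_(i : I) G (enum_rank i).
  by rewrite (reindex (@enum_rank I)) //; exact: onW_bij (enum_rank_bij I).
have [[y [y0 ->]]|[x [ax cx]]] := farkas_nat #|I| a' c; [left|right].
  exists (fun i => y (enum_rank i)); split => [i|]; first exact: y0.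
  by rewrite (sumE (fun k => y k *: a' k)); apply: eq_bigr => i _; rewrite a'E.
by exists x; split => // i; rewrite -a'E ax.
Qed.

Lemma dot_row_mx (F : comPzRingType) n (c x : 'rV[F]_n) (d t : F) :
  dot (row_mx c d%:M) (row_mx x t%:M) = dot c x + d * t.
Proof.
rewrite /dot big_split_ord /= big_ord1 !row_mxEr !mxE !mulr1n; congr (_ + _).
by apply: eq_bigr => i _; rewrite !row_mxEl.
Qed.

(** Homogenization: [farkas] for the generators [(a i, b i)] and [(0, 1)] against [(c, d)]. The last
    coordinate [t] of a separating vector is nonpositive; [t < 0] scales to a point, and [t = 0]
    leaves a recession direction. *)
Lemma farkas_affine (F : realFieldType) n (I : finType) (a : I -> 'rV[F]_n) (b : I -> F)
    (c : 'rV[F]_n) (d : F) :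
  [\/ exists y : I -> F, [/\ forall i, 0 <= y i, c = \sum_i y i *: a i
                          & \sum_i y i * b i <= d],
      exists x, (forall i, dot (a i) x <= b i) /\ d < dot c x
    | exists r, (forall i, dot (a i) r <= 0) /\ 0 < dot c r].
Proof.
pose a' (i : option I) := if i is Some i then row_mx (a i) (b i)%:M else row_mx 0 1%:M.
have [[y [y0 cE]]|[r [ar cr]]] := farkas a' (row_mx c d%:M).
  move: cE; rewrite (bigD1 None) //= scale_row_mx scaler0.
  rewrite (reindex_omap Some id) /=; last by case.
  rewrite (eq_bigl xpredT) => [|i]; last by rewrite eqxx.
  have -> : \sum_i y (Some i) *: row_mx (a i) (b i)%:M =
      row_mx (\sum_i y (Some i) *: a i) (\sum_i y (Some i) * b i)%:M.
    elim/big_rec3: _ => [|i u v w _ ->]; first by rewrite raddf0 row_mx0.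
    by rewrite scale_row_mx add_row_mx raddfD /= scale_scalar_mx.
  rewrite add_row_mx add0r scale_scalar_mx mulr1 -raddfD /= => /eq_row_mx[-> /matrixP/(_ 0 0)].
  rewrite !mxE !mulr1n => ->; constructor 1.
  by exists (fun i => y (Some i)); split => //; rewrite lerDr.
move: r ar cr => r; rewrite -[r]hsubmxK [rsubmx r]mx11_scalar.
set x := lsubmx r; set t := rsubmx r 0 0 => ar; rewrite dot_row_mx => cr.
have ax i : dot (a i) x + b i * t <= 0 by have := ar (Some i); rewrite /= dot_row_mx.
have : t <= 0 by have := ar None; rewrite /= dot_row_mx dot0l mul1r add0r.
rewrite le_eqVlt => /predU1P[t0|t0].
  constructor 3; exists x; split => [i|]; first by have := ax i; rewrite t0 mulr0 addr0.
  by move: cr; rewrite t0 mulr0 addr0.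
constructor 2; exists ((- t)^-1 *: x); have nt0 : 0 < - t by rewrite oppr_gt0.
split => [i|]; rewrite dotZr mulrC.
  by rewrite ler_pdivrMr // mulrN -subr_ge0; have := ax i; lra.
by rewrite ltr_pdivlMr //; lra.
Qed.

(** * Polyhedra with integer normal vectors *)
Lemma rV_rat_scale n (v : 'rV[rat]_n) :
  exists (D : int) (w : 'rV[int]_n), 0 < D /\ D%:~R *: v = map_mx intr w.
Proof.
exists (\prod_k denq (v 0 k)), (\row_k (numq (v 0 k) * \prod_(l | l != k) denq (v 0 l))).
split; first by apply: prodr_gt0 => k _; apply: denq_gt0.
apply/rowP=> k; rewrite !mxE (bigD1 k) //= !rmorphM /= mulrAC; congr (_ * _).
by rewrite numqE mulrC.
Qed.

Lemma lub_exists (R : realType) (E : R -> Prop) : (exists x, E x) ->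
  (exists b, forall x, E x -> x <= b) ->
  exists s, (forall x, E x -> x <= s) /\ forall b, (forall x, E x -> x <= b) -> s <= b.
Proof.
move=> E0 [b Eb]; exists (sup (E : set R)); split.
  by move=> x Ex; apply: ub_le_sup => //; exists b => y; exact: Eb.
by move=> d Ed; apply: ge_sup => // y; exact: Ed.
Qed.

Lemma glb_exists (R : realType) (E : R -> Prop) : (exists x, E x) ->
  (exists b, forall x, E x -> b <= x) ->
  exists s, (forall x, E x -> s <= x) /\ forall b, (forall x, E x -> b <= x) -> b <= s.
Proof.
move=> [x0 Ex0] [b Eb].
have [||s [sE sm]] := @lub_exists R (fun x => E (- x)).
- by exists (- x0); rewrite opprK.
- by exists (- b) => x /Eb; rewrite lerNr.
exists (- s); split=> [x Ex|d Ed]; first by rewrite lerNl; apply: sE; rewrite opprK.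
by rewrite lerNr; apply: sm => x /Ed; rewrite lerNr.
Qed.

Section IntegerPolyhedra.
Variable R : realType.
Implicit Type n : nat.

Lemma int_vecP n (x : 'rV[R]_n) : int_vec x <-> exists v, x = map_mx intr v.
Proof.
split=> [xi|[v ->] i]; last by rewrite mxE intr_int.
by exists (map_mx Num.floor x); apply/rowP=> i; rewrite !mxE floorK.
Qed.

Lemma int_vec_map n (v : 'rV[int]_n) : int_vec (map_mx intr v : 'rV[R]_n).
Proof. by apply/int_vecP; exists v. Qed.

(** Integrality of the normals alone makes the closure finitely described, so the right-hand sides
    may be real. *)
Definition ipoly n (Q : pset R n) :=
  exists (I : finType) (a : I -> 'rV[int]_n) (b : I -> R),
    forall x, Q x <-> forall i, dot (map_mx intr (a i)) x <= b i.

Definition slice n (Q : pset R n.+1) (u : 'rV[int]_n.+1) (N : 'M[int]_(n, n.+1)) (j : R) :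
    pset R n :=
  fun y => Q (pt (map_mx intr u) (map_mx intr N) j y).

Lemma ipoly_slice n (Q : pset R n.+1) u N j : ipoly Q -> ipoly (slice Q u N j).
Proof.
move=> [I [a [b Qab]]].
exists I, (fun i => a i *m N^T), (fun i => b i - j * dot (map_mx intr (a i)) (map_mx intr u)).
move=> y; rewrite /slice Qab; split=> H i; have := H i;
  by rewrite dotDr dotZr dot_mulmxr map_trmx -map_mxM lerBrDl.
Qed.

Lemma ipoly_convex n (Q : pset R n) x y (s t : R) : ipoly Q -> Q x -> Q y ->
  0 <= s -> 0 <= t -> s + t = 1 -> Q (s *: x + t *: y).
Proof.
move=> [I [a [b Qab]]] /Qab Qx /Qab Qy s0 t0 st; apply/Qab => i.
rewrite dotDr !dotZr (_ : b i = s * b i + t * b i); last by rewrite -mulrDl st mul1r.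
by apply: lerD; apply: ler_wpM2l; rewrite ?Qx ?Qy.
Qed.

Lemma rational_ipoly n (Q : pset R n) : rational_polyhedron Q -> ipoly Q.
Proof.
move=> [m [A [b QAb]]].
have /choice[D /choice[w Dw]] : forall j, exists (D : int) (w : 'rV[int]_n),
    0 < D /\ D%:~R *: row j A = map_mx intr w.
  by move=> j; exact: rV_rat_scale.
exists 'I_m, w, (fun j => (D j)%:~R * ratr (b j 0)) => x.
have dotw j : dot (map_mx intr (w j)) x = (D j)%:~R * dot (row j (map_mx ratr A)) x.
  have [D0 DE] := Dw j; rewrite -dotZl; congr dot.
  apply/rowP=> k; move/rowP/(_ k): DE; rewrite !mxE => /(congr1 (@ratr R)).
  by rewrite rmorphM /= !ratr_int.
by rewrite QAb; split=> H j; have := H j; have [D0 _] := Dw j;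
  rewrite dotw ler_pM2l // ltr0z.
Qed.

(** [farkas] is applied over the rationals to each signed unit vector: multipliers bound that
    coordinate, while a separating vector is a rational recession direction, made integral by
    clearing denominators. *)
Lemma ipoly_recession n (I : finType) (a : I -> 'rV[int]_n) (b : I -> R) :
  (exists B : R, forall x, (forall i, dot (map_mx intr (a i)) x <= b i) ->
     forall k, `|x 0 k| <= B) \/
  (exists r : 'rV[int]_n, r != 0 /\ forall i, dot (a i) r <= 0).
Proof.
have [|nr] := EM (exists r : 'rV[int]_n, r != 0 /\ forall i, dot (a i) r <= 0).
  by right.
left.
have bnd (e : 'rV[int]_n) : exists B : R, forall x, (forall i, dot (map_mx intr (a i)) x <= b i) ->
    dot (map_mx intr e) x <= B.
  have [[y [y0 eE]]|[r [ar er]]] := farkas (fun i => map_mx intr (a i) : 'rV[rat]_n)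
                                 (map_mx intr e).
    exists (\sum_i ratr (y i) * b i) => x ax.
    have -> : map_mx intr e = \sum_i ratr (y i) *: map_mx intr (a i) :> 'rV[R]_n.
      apply/rowP=> k; move/rowP/(_ k): eE; rewrite !mxE summxE => /(congr1 (@ratr R)).
      rewrite ratr_int => ->; rewrite rmorph_sum summxE; apply: eq_bigr => i _.
      by rewrite !mxE rmorphM /= ratr_int.
    rewrite dot_suml; apply: ler_sum => i _; rewrite dotZl.
    by apply: ler_wpM2l => //; rewrite ler0q.
  have [D [w [D0 Dw]]] := rV_rat_scale r.
  case: nr; exists w; split=> [|i].
    apply: contraTneq er => w0; move: Dw; rewrite w0 map_mx0 => /eqP.
    rewrite scaler_eq0 intr_eq0 gt_eqF //= => /eqP ->.
    by rewrite dot0r ltxx.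
  have := ar i; rewrite -(pmulr_rle0 _ (_ : 0 < D%:~R)) ?ltr0z // -dotZr Dw dot_map.
  by rewrite lerz0.
have /choice[B HB] := fun k => bnd (delta_mx 0 k).
have /choice[C HC] := fun k => bnd (- delta_mx 0 k).
exists (\sum_k (`|B k| + `|C k|)) => x ax k.
rewrite (le_trans (_ : _ <= `|B k| + `|C k|)) //; last first.
  by rewrite (bigD1 k) //= lerDl sumr_ge0 // => i _; rewrite addr_ge0.
have := HB k x ax; have := HC k x ax.
rewrite map_mxN dotNl map_delta_mx dot_delta => h1 h2.
have := ler_norm (B k); have := ler_norm (C k).
have := normr_ge0 (B k); have := normr_ge0 (C k).
by rewrite ler_norml => *; apply/andP; split; lra.
Qed.

(** * Chvátal-Gomory closures of polyhedra *)

Lemma cg_closure_mono n (A B : pset R n) :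
  (forall x, A x -> B x) -> forall x, cg_closure A x -> cg_closure B x.
Proof.
move=> AB x [Ax cx]; split; first exact: AB.
by move=> c d ci Bd; apply: cx => // y /AB /Bd.
Qed.

Lemma cg_closure_int n (Q : pset R n) x : int_vec x -> Q x -> cg_closure Q x.
Proof.
move=> xi Qx; split=> // c d ci /(_ x Qx); rewrite -[dotv c x]/(dot c x).
move: xi ci => /int_vecP[v ->] /int_vecP[w ->].
by rewrite dot_map ler_int floor_ge_int.
Qed.

Lemma cg_iterS n k (Q : pset R n) x : cg_iter k.+1 Q x -> cg_iter k Q x.
Proof. by case. Qed.

Lemma cg_iterD n k l (Q : pset R n) : cg_iter (k + l) Q = cg_iter k (cg_iter l Q).
Proof. exact: iterD. Qed.

Lemma cg_iter_sub n k l (Q : pset R n) x : (l <= k)%N -> cg_iter k Q x -> cg_iter l Q x.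
Proof.
move=> /subnK <-; elim: (k - l)%N => // m IH /cg_iterS; exact: IH.
Qed.

Lemma cg_iter_base n k (Q : pset R n) x : cg_iter k Q x -> Q x.
Proof. exact: (@cg_iter_sub _ k 0). Qed.

Lemma cg_iter_int n k (Q : pset R n) x : int_vec x -> Q x -> cg_iter k Q x.
Proof. by move=> xi Qx; elim: k => //= k IH; apply: cg_closure_int. Qed.

Lemma ipoly_empty n (Q : pset R n) : (forall x, ~ Q x) -> ipoly Q.
Proof.
move=> Q0; exists unit, (fun=> 0), (fun=> -1) => x; split=> [/Q0//|/(_ tt)].
by rewrite map_mx0 dot0l; lra.
Qed.

(* An inequality [c x <= d] valid for [Q] is a nonnegative combination of the
   given ones; subtracting the integer parts of the multipliers leaves one of
   finitely many integer vectors, whose cut implies the cut of [c x <= d]. *)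
Lemma ipoly_cg_closure n (Q : pset R n) : ipoly Q -> ipoly (cg_closure Q).
Proof.
move=> [I [a [b Qab]]].
have [[x0 Qx0]|Q0] := EM (exists x, Q x); last first.
  by apply: ipoly_empty => x [Qx _]; apply: Q0; exists x.
(* A combination of the normals with multipliers in [[0, 1]] has coordinates bounded by [B]; [vec]
   enumerates the integer vectors of that box. *)
pose B := (\sum_i \sum_k `|a i 0%R k|)%N.
pose vec (f : {ffun 'I_n -> 'I_(B + B).+1}) : 'rV[int]_n := \row_k ((f k)%:Z - B%:Z).
have /choice[p pP] : forall f, exists p : 'rV[int]_n * R,
    (forall x, cg_closure Q x -> dot (map_mx intr p.1) x <= p.2) /\
    forall (d : R) x, (forall y, Q y -> dot (map_mx intr (vec f)) y <= d) ->
      dot (map_mx intr p.1) x <= p.2 -> dot (map_mx intr (vec f)) x <= (Num.floor d)%:~R.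
  move=> f; have [[d Qd]|nb] := EM (exists d, forall y, Q y -> dot (map_mx intr (vec f)) y <= d);
    last first.
    (* The trivial inequality [0 <= 0] stands in for a functional unbounded on [Q]. *)
    exists (0, 0); split=> [x _|d x Qd]; first by rewrite map_mx0 dot0l.
    by case: nb; exists d.
  have [||s [sub sle]] := @lub_exists R (fun t => exists2 y, Q y & t = dot (map_mx intr (vec f)) y).
  - by exists (dot (map_mx intr (vec f)) x0), x0.
  - by exists d => _ [y /Qd ? ->].
  exists (vec f, (Num.floor s)%:~R); split=> [x [_ /(_ (map_mx intr (vec f)) s)]|e x Qe /= h] /=.
    by apply; [exact: int_vec_map | move=> y Qy; apply: sub; exists y].
  by apply: (le_trans h); rewrite ler_int le_floor // sle // => _ [y /Qe ? ->].
pose a' (i : I + {ffun 'I_n -> 'I_(B + B).+1}) := match i with inl i => a i | inr f => (p f).1 end.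
pose b' (i : I + {ffun 'I_n -> 'I_(B + B).+1}) : R :=
  match i with inl i => (Num.floor (b i))%:~R | inr f => (p f).2 end.
exists _, a', b' => x; split.
  move=> Qx [i|f] /=; last by case: (pP f) => + _; apply.
  case: Qx => _; apply; first exact: int_vec_map.
  by move=> y /Qab; apply.
move=> abx.
have Qx : Q x by apply/Qab => i; apply: le_trans (abx (inl i)) _; exact: floor_le.
split=> // _ d /int_vecP[c ->] cd.
have [[y [y0 cE yb]]|[z [/Qab/cd]]|[r [ar cr]]] := farkas_affine (fun i => map_mx intr (a i)) b
  (map_mx intr c) d.
- pose z i := Num.floor (y i).
  have z0 i : 0 <= z i by rewrite floor_ge0.
  pose s := c - \sum_i z i *: a i.
  have sE : map_mx intr s = \sum_i (y i - (z i)%:~R) *: map_mx intr (a i) :> 'rV[R]_n.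
    rewrite map_mxB cE raddf_sum /= -sumrB; apply: eq_bigr => i _.
    by rewrite scalerBl map_mxZ.
  have fr i : 0 <= y i - (z i)%:~R <= 1.
    have /andP[h1] := floor_itv (y i); rewrite intrD subr_ge0 h1 /z => h2; lra.
  have sB k : `|s 0 k| <= B%:Z.
    rewrite -(ler_int R) intr_norm.
    have -> : (s 0 k)%:~R = (map_mx intr s : 'rV[R]_n) 0 k by rewrite [RHS]mxE.
    rewrite sE summxE (le_trans (ler_norm_sum _ _ _)) //.
    rewrite -[B%:Z%:~R]/(B%:R : R) /B natr_sum.
    apply: ler_sum => i _; rewrite !mxE normrM.
    have /andP[h1 h2] := fr i; rewrite ger0_norm //.
    rewrite (le_trans (ler_wpM2r (normr_ge0 _) h2)) // mul1r -intr_norm -abszE.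
    by rewrite -[_%:~R]/(`|a i 0%R k|%N%:R) ler_nat (bigD1 k) //= leq_addr.
  have [f fE] : exists f, vec f = s.
    exists [ffun k => inord (absz (s 0 k + B%:Z))]; apply/rowP=> k; rewrite mxE ffunE.
    have := sB k; rewrite ler_norml => /andP[h1 h2].
    have h3 : 0 <= s 0 k + B%:Z by rewrite -lerBlDr sub0r.
    rewrite inordK ?gez0_abs //; first by rewrite addrK.
    by rewrite ltnS -lez_nat gez0_abs // PoszD lerD2r.
  have sx : dot (map_mx intr s) x <= (Num.floor (\sum_i (y i - (z i)%:~R) * b i))%:~R.
    rewrite -fE; case: (pP f) => _; apply; last exact: (abx (inr f)).
    move=> w /Qab Qw; rewrite fE sE dot_suml; apply: ler_sum => i _.
    by rewrite dotZl; apply: ler_wpM2l => //; case/andP: (fr i).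
  have -> : map_mx intr c = map_mx intr s + \sum_i (z i)%:~R *: map_mx intr (a i) :> 'rV[R]_n.
    by rewrite sE cE -big_split; apply: eq_bigr => i _ /=; rewrite scalerBl subrK.
  rewrite -[dotv _ _]/(dot _ x) dotDl dot_suml.
  apply: (@le_trans _ _ (Num.floor (\sum_i (y i - (z i)%:~R) * b i) +
                         \sum_i z i * Num.floor (b i))%:~R).
    rewrite intrD; apply: lerD => //; rewrite raddf_sum /=; apply: ler_sum => i _.
    rewrite dotZl intrM; apply: ler_wpM2l; first by rewrite ler0z.
    exact: (abx (inl i)).
  rewrite ler_int floor_ge_int (le_trans _ yb) // intrD raddf_sum /=.
  have -> : \sum_i y i * b i = \sum_i (y i - (z i)%:~R) * b i + \sum_i (z i)%:~R * b i.
    by rewrite -big_split; apply: eq_bigr => i _ /=; rewrite -mulrDl subrK.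
  apply: lerD; first exact: floor_le.
  apply: ler_sum => i _; rewrite intrM; apply: ler_wpM2l; last exact: floor_le.
  by rewrite ler0z.
- by rewrite -[dotv _ _]/(dot _ z) leNgt => /negbTE ->.
(* Moving from [x0] by [t] along [r] overshoots the bound [d] by exactly [dot c r]. *)
- pose t := (d - dot (map_mx intr c) x0) / dot (map_mx intr c) r + 1.
  have h0 : 0 <= d - dot (map_mx intr c) x0 by rewrite subr_ge0; exact: cd.
  have t0 : 0 <= t by rewrite addr_ge0 // divr_ge0 // ltW.
  have : Q (x0 + t *: r).
    apply/Qab => i; rewrite dotDr dotZr.
    have /Qab/(_ i) h1 := Qx0; have := mulr_ge0_le0 t0 (ar i); lra.
  move/cd; rewrite -[dotv _ _]/(dot _ (x0 + t *: r)) dotDr dotZr mulrDl divfK ?gt_eqF //.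
  lra.
Qed.

Lemma ipoly_cg_iter n k (Q : pset R n) : ipoly Q -> ipoly (cg_iter k Q).
Proof. by move=> pQ; elim: k => //= k IH; apply: ipoly_cg_closure. Qed.

End IntegerPolyhedra.

(** * Faces and layers *)
Section Faces.
Variable R : realType.
Implicit Type n : nat.

(** Farkas' lemma for [Q] with the row [c x >= j] added gives a multiplier for that row; as
    [c x <= j] on [Q], it may be rounded up to a natural number [m], which keeps the tilted normal
    integral when [c] and [d] are. The last hypothesis rules out a recession direction of the face
    along which [d] grows. *)
Lemma ipoly_face_lift n (Q : pset R n) (c : 'rV[R]_n) (j : R) (d : 'rV[R]_n) (e : R) :
  ipoly Q ->
  (forall x, Q x -> dot c x <= j) ->
  (forall x, Q x -> dot c x = j -> dot d x <= e) ->
  (exists2 x, Q x & dot c x = j) \/ d = 0 ->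
  exists m : nat, forall x, Q x -> dot (d + m%:R *: c) x <= e + m%:R * j.
Proof.
move=> [I [a [b Qab]]] cj de nonempty.
pose a' i : 'rV[R]_n := if i is Some i then map_mx intr (a i) else - c.
pose b' i := if i is Some i then b i else - j.
have [[y [y0 dE yb]]|[x [ax dx]]|[r [ar dr]]] := farkas_affine a' b' d e.
- have [m my] : exists m : nat, y None <= m%:R.
    by exists (Num.bound (y None)); rewrite ltW // archi_boundP.
  exists m => x Qx.
  have dxE : dot d x + y None * dot c x = \sum_i y (Some i) * dot (map_mx intr (a i)) x.
    rewrite dE dot_suml (bigD1 None) //= !dotZDE.
    rewrite (reindex_omap Some id) /=; last by case.
    rewrite mulrN addrAC addNr add0r (eq_bigl xpredT) => [|i]; last by rewrite eqxx.
    by apply: eq_bigr => i _; rewrite dotZl.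
  have le1 : dot d x + y None * dot c x <= \sum_i y (Some i) * b i.
    rewrite dxE; apply: ler_sum => i _; apply: ler_wpM2l => //.
    by move/Qab: Qx.
  have le2 : \sum_i y (Some i) * b i <= e + y None * j.
    move: yb; rewrite (bigD1 None) //= (reindex_omap Some id) /=; last by case.
    rewrite (eq_bigl xpredT) => [|i]; last by rewrite eqxx.
    by rewrite mulrN addrC lerBlDr.
  rewrite dotDl dotZl.
  have := mulr_ge0_le0 (_ : 0 <= m%:R - y None) (_ : dot c x - j <= 0).
  rewrite !subr_ge0 subr_le0 => /(_ my (cj x Qx)); lra.
- have Qx : Q x by apply/Qab => i; exact: (ax (Some i)).
  have := ax None; rewrite /= dotNl lerN2 => jc.
  have := de x Qx; rewrite leNgt dx => /(_ _)/negP[] //.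
  by apply/eqP; rewrite eq_le cj.
- case: nonempty => [[x0 Qx0 cx0]|d0]; last by move: dr; rewrite d0 dot0l ltxx.
  have Qr t : 0 <= t -> Q (x0 + t *: r).
    move=> t0; apply/Qab => i; rewrite dotDr dotZr.
    have /Qab/(_ i) h1 := Qx0; have := mulr_ge0_le0 t0 (ar (Some i)) => /=; lra.
  have cr : dot c r = 0.
    apply/eqP; rewrite eq_le; apply/andP; split.
      by have := cj _ (Qr 1 ler01); rewrite dotDr dotZr mul1r cx0; lra.
    by have := ar None; rewrite /= dotNl oppr_le0.
  pose t := (e - dot d x0) / dot d r + 1.
  have h0 : 0 <= e - dot d x0 by rewrite subr_ge0; apply: de.
  have t0 : 0 <= t by rewrite addr_ge0 // divr_ge0 // ltW.
  have := de _ (Qr t t0).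
  rewrite !dotDr !dotZr cr mulr0 addr0 mulrDl divfK ?gt_eqF // => /(_ cx0); lra.
Qed.

Variables (n : nat) (c u : 'rV[int]_n.+1) (N : 'M[int]_(n, n.+1)) (M : 'M[int]_(n.+1, n)).
Hypothesis fr : frame c u N M.

Let frR : frame (map_mx intr c : 'rV[R]_n.+1) (map_mx intr u) (map_mx intr N) (map_mx intr M)
  := frame_map intr fr.

Lemma slice_int (j : int) (y : 'rV[R]_n) :
  int_vec y -> int_vec (pt (map_mx intr u) (map_mx intr N) j%:~R y).
Proof.
move=> /int_vecP[v ->]; apply/int_vecP; exists (j *: u + v *m N).
by rewrite map_mxD map_mxZ map_mxM.
Qed.

Lemma slice_proj (Q : pset R n.+1) (j : R) x :
  Q x -> dot (map_mx intr c) x = j -> slice Q u N j (x *m map_mx intr M).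
Proof. by move=> Qx <-; rewrite /slice (frame_ptK frR). Qed.

(** A valid inequality of the slice is tilted by a multiple of [c] into one valid for [Q]. Since
    [m * j] is an integer it passes through the floor, so the two cuts agree on the face. *)
Lemma cg_closure_face (Q : pset R n.+1) (j : int) x : ipoly Q ->
  (forall x, Q x -> dot (map_mx intr c) x <= j%:~R) ->
  cg_closure Q x -> dot (map_mx intr c) x = j%:~R ->
  cg_closure (slice Q u N j%:~R) (x *m map_mx intr M).
Proof.
move=> pQ cj [Qx cut] cx; split; first exact: slice_proj.
move=> _ e /int_vecP[d ->] de.
have [|||m dm] := @ipoly_face_lift _ Q (map_mx intr c) j%:~R (map_mx intr (d *m M^T)) e pQ.
- exact: cj.
- move=> z Qz cz; have := de _ (slice_proj Qz cz).
  by rewrite -[dotv _ _]/(dot _ (z *m _)) dot_mulmxr map_trmx map_mxM.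
- by left; exists x.
have mj : m%:R * j%:~R = (m%:Z * j)%:~R :> R by rewrite intrM.
have := cut (map_mx intr (d *m M^T + m%:Z *: c)) (e + m%:R * j%:~R) (@int_vec_map R _ _).
rewrite map_mxD map_mxZ => /(_ dm).
rewrite -[dotv _ x]/(dot _ x) -[dotv _ (x *m _)]/(dot _ (x *m _)).
rewrite dot_mulmxr map_trmx -map_mxM dotDl dotZl cx mj.
by rewrite floorDrz ?intr_int // intrKfloor intrD lerD2r.
Qed.


Lemma cg_iter_face k (Q : pset R n.+1) (j : int) x : ipoly Q ->
  (forall x, Q x -> dot (map_mx intr c) x <= j%:~R) ->
  cg_iter k Q x -> dot (map_mx intr c) x = j%:~R ->
  cg_iter k (slice Q u N j%:~R) (x *m map_mx intr M).
Proof.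
move=> pQ cj; elim: k x => [|k IH] x Qx cx; first exact: slice_proj.
apply: cg_closure_mono (cg_closure_face (ipoly_cg_iter k pQ) _ Qx cx) => [y Qy|y Qy].
  by rewrite -(frame_pt_proj frR j%:~R y); apply: IH; rewrite ?(frame_dot_pt frR).
by apply: cj; apply: cg_iter_base Qy.
Qed.

Variable th : nat.
Hypothesis kill : forall Q : pset R n, ipoly Q -> (forall x, int_vec x -> ~ Q x) ->
  forall x, ~ cg_iter th Q x.

(** After [th] rounds the face [c x = j] is empty, so even [0 <= -1] is valid on it; tilting this
    gives [m * c x <= m * j - 1] with [m > 0]. One more round takes [j - 1 / m] down to [j - 1]. *)
Lemma cg_layer (Q : pset R n.+1) (j : int) x : ipoly Q ->
  (forall x, Q x -> dot (map_mx intr c) x <= j%:~R) ->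
  (forall x, int_vec x -> Q x -> dot (map_mx intr c) x <> j%:~R) ->
  cg_iter th.+1 Q x -> dot (map_mx intr c) x <= (j - 1)%:~R.
Proof.
move=> pQ cj Qj [Qx cut].
have noface y : cg_iter th Q y -> dot (map_mx intr c) y <> j%:~R.
  move=> Qy cy; apply: (kill (ipoly_slice u N j%:~R pQ)) (cg_iter_face pQ cj Qy cy).
  by move=> z /(slice_int j) zi Qz; apply: (Qj _ zi Qz); apply: (frame_dot_pt frR).
have [|||m mP] := @ipoly_face_lift _ (cg_iter th Q) (map_mx intr c) j%:~R 0 (-1)
  (ipoly_cg_iter th pQ).
- by move=> y /cg_iter_base /cj.
- by move=> y Qy /(noface y Qy).
- by right.
have m0 : 0 < m%:R :> R.
  rewrite ltr0n lt0n; apply/negP => /eqP m0; have := mP x Qx.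
  by rewrite m0 !mul0r scale0r addr0 dot0l; lra.
have := cut (map_mx intr c) (j%:~R - m%:R^-1) (int_vec_map _ _).
rewrite -[dotv _ _]/(dot _ x) => h; apply: (le_trans (h _)) => [y Qy|].
  rewrite -[dotv _ _]/(dot _ y) -(ler_pM2l m0) mulrBr mulfV ?gt_eqF //.
  by have := mP y Qy; rewrite add0r dotZl addrC.
by rewrite ler_int -ltzD1 subrK floor_lt_int ltrBlDr ltrDl invr_gt0.
Qed.

Lemma cg_layers m (Q : pset R n.+1) (j : int) x : ipoly Q ->
  (forall x, Q x -> dot (map_mx intr c) x <= j%:~R) ->
  (forall x, int_vec x -> Q x -> dot (map_mx intr c) x <= (j - m%:Z)%:~R) ->
  cg_iter (m * th.+1) Q x -> dot (map_mx intr c) x <= (j - m%:Z)%:~R.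
Proof.
move=> pQ cj; elim: m x => [|m IH] x Qj; first by rewrite subr0; apply: cj.
rewrite mulSn cg_iterD => /cg_layer -/(_ (j - m%:Z)) h.
have jE : j - m.+1%:Z = j - m%:Z - 1 by rewrite -[m.+1]addn1 PoszD opprD addrA.
rewrite jE; apply: h; first exact: ipoly_cg_iter.
  move=> y; apply: IH => z zi /(Qj z zi) /le_trans; apply.
  by rewrite ler_int lerD2l lerN2 lez_nat.
move=> z zi /cg_iter_base /(Qj z zi) /[swap] ->.
by rewrite ler_int lerD2l lerN2 lez_nat ltnn.
Qed.

End Faces.

(** * The flatness theorem *)
Section Shear.
Variables (R : realType) (n : nat) (K : pset R n).
Hypothesis cvx : forall x y s t, K x -> K y -> 0 <= s -> 0 <= t -> s + t = 1 ->
  K (s *: x + t *: y).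
Implicit Types c d : 'rV[R]_n.

(** The weights [s] and [t] are the distances of the two values of [c] from [j]; they are returned
    unnormalized because later estimates use them. *)
Lemma slice_crossing c x y (j : R) : K x -> K y -> dot c y < j -> j < dot c x ->
  exists s t, [/\ 0 < s, 0 < t, K ((s + t)^-1 *: (s *: x + t *: y)),
    dot c ((s + t)^-1 *: (s *: x + t *: y)) = j & s = j - dot c y /\ t = dot c x - j].
Proof.
move=> Kx Ky yj jx; pose s := j - dot c y; pose t := dot c x - j.
have s0 : 0 < s by rewrite subr_gt0.
have t0 : 0 < t by rewrite subr_gt0.
have st0 : s + t != 0 by rewrite gt_eqF // addr_gt0.
exists s, t; split => //.
  rewrite scalerDr !scalerA; apply: cvx => //.
  - by rewrite ltW // mulr_gt0 // invr_gt0 addr_gt0.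
  - by rewrite ltW // mulr_gt0 // invr_gt0 addr_gt0.
  - by rewrite -mulrDr mulVf.
rewrite !dotZDE; apply: (mulfI st0); rewrite mulrA mulfV // mul1r /s /t; ring.
Qed.

(** Slopes measured from the level [j] at points above it never exceed those at points below it,
    because the segment joining two such points crosses the slice, where [d <= b]. The supremum of
    the former serves both sides. *)
Lemma supporting_slope c d (j b : R) :
  (exists2 x, K x & j < dot c x) -> (exists2 y, K y & dot c y < j) ->
  (forall x, K x -> dot c x = j -> dot d x <= b) ->
  exists s, forall x, K x -> dot d x <= b + s * (dot c x - j).
Proof.
move=> [x0 Kx0 jx0] [y0 Ky0 y0j] db.
have cross x y : K x -> K y -> dot c y < j -> j < dot c x ->
    (dot d x - b) / (dot c x - j) <= (b - dot d y) / (j - dot c y).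
  move=> Kx Ky yj jx; have [s [t [s0 t0 Kz cz [sE tE]]]] := slice_crossing Kx Ky yj jx.
  rewrite -sE -tE ler_pdivrMr // mulrAC ler_pdivlMr //.
  have := db _ Kz cz; rewrite !dotZDE mulrC ler_pdivrMr ?addr_gt0 //; nra.
have [||s [sub sle]] := @lub_exists R
  (fun t => exists x, [/\ K x, j < dot c x & t = (dot d x - b) / (dot c x - j)]).
- by exists ((dot d x0 - b) / (dot c x0 - j)), x0.
- by exists ((b - dot d y0) / (j - dot c y0)) => _ [x [Kx jx ->]]; exact: cross.
exists s => x Kx; have [xj|jx|xj] := ltgtP (dot c x) j.
- have : s <= (b - dot d x) / (j - dot c x).
    by apply: sle => _ [z [Kz jz ->]]; exact: cross.
  by rewrite ler_pdivlMr ?subr_gt0 //; nra.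
- have : (dot d x - b) / (dot c x - j) <= s by apply: sub; exists x.
  by rewrite ler_pdivrMr ?subr_gt0 //; lra.
- by rewrite xj subrr mulr0 addr0; apply: db.
Qed.

(* Two supporting slopes at the ends of the slice bound [K] by a trapezoid;
   since both parallel sides have nonnegative length, it is at most three
   times as long as the slice everywhere between [A] and [B]. *)
Lemma shear c d (A B j al be : R) :
  (forall x, K x -> A <= dot c x) -> (forall t, (forall x, K x -> t <= dot c x) -> t <= A) ->
  (forall x, K x -> dot c x <= B) -> (forall t, (forall x, K x -> dot c x <= t) -> B <= t) ->
  A < j -> j < B -> j - A <= 2 * (B - j) -> B - j <= 2 * (j - A) ->
  (forall x, K x -> dot c x = j -> al <= dot d x <= be) ->
  exists t, forall x y, K x -> K y -> dot (d + t *: c) (x - y) <= 3 * (be - al).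
Proof.
move=> KA Ainf KB Bsup Aj jB jA2 jB2 dab.
have up : exists2 x, K x & j < dot c x.
  apply: contrapT => nx; suff : B <= j by rewrite leNgt jB.
  by apply: Bsup => x Kx; rewrite leNgt; apply/negP => jx; apply: nx; exists x.
have dn : exists2 x, K x & dot c x < j.
  apply: contrapT => nx; suff : j <= A by rewrite leNgt Aj.
  by apply: Ainf => x Kx; rewrite leNgt; apply/negP => jx; apply: nx; exists x.
have [|s2 s2P] := @supporting_slope c d j be up dn.
  by move=> x Kx /(dab x Kx)/andP[].
have [|s1 s1P] := @supporting_slope c (- d) j (- al) up dn.
  by move=> x Kx /(dab x Kx)/andP[+ _]; rewrite dotNl lerN2.
(* [l + s * (c x - j)] is the length of the trapezoid at the level of [x]. It is affine and
   nonnegative on the whole range, and [j] divides [[A, B]] within ratio 2, whence the bound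
   [3 * l]. *)
pose l := be - al; pose s := s1 + s2.
have gap x : K x -> 0 <= l + s * (dot c x - j).
  by move=> Kx; have := s1P x Kx; have := s2P x Kx; rewrite dotNl /l /s; lra.
have l0 : 0 <= l.
  have [[x Kx jx] [y Ky yj]] := (up, dn).
  by have := gap x Kx; have := gap y Ky; have [|] := leP 0 s; nra.
have gap3 x : K x -> l + s * (dot c x - j) <= 3 * l.
  move=> Kx; have h1 := KA x Kx; have h2 := KB x Kx.
  have [s0|s0] := ltP s 0.
    have : B <= j + l / - s.
      apply: Bsup => y Ky; rewrite -lerBlDl ler_pdivlMr ?oppr_gt0 //.
      by have := gap y Ky; lra.
    rewrite -lerBlDl ler_pdivlMr ?oppr_gt0 //; nra.
  move: s0; rewrite le_eqVlt => /predU1P[<-|s0]; first by rewrite mul0r; lra.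
  have : j - l / s <= A.
    apply: Ainf => y Ky; rewrite lerBlDr -lerBlDl ler_pdivlMr //.
    by have := gap y Ky; lra.
  rewrite lerBlDr -lerBlDl ler_pdivlMr //; nra.
exists s1 => x y Kx Ky; rewrite !dotZDE.
have := s1P y Ky; have := s2P x Kx; have := gap3 x Kx.
by rewrite dotNl /l /s; lra.
Qed.

End Shear.

(* The point is required off the hyperplane [h x = g], or just to exist when [h = 0]
   and [g != 0]; this covers polyhedra whose integer points lie in a subspace. *)
Definition flat_bound (R : realType) n (W : nat) := forall K : pset R n, ipoly K ->
  (exists x, K x) ->
  (forall c : 'rV[int]_n, c != 0 ->
     exists x y, [/\ K x, K y & W%:R <= dot (map_mx intr c) (x - y)]) ->
  forall (h : 'rV[R]_n) (g : R), h != 0 \/ g != 0 ->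
  exists x, [/\ int_vec x, K x & dot h x != g].

(** Projection along the primitive recession direction [r1] sends [K] into [K2], cut out by the
    inequalities constant along [r1]. Integer points of [K2] lift to integer points of [K] far
    enough along [r1], since each remaining left-hand side drops by at least 1 per step. *)
Lemma flat_bound_unbounded (R : realType) n W (I : finType) (a : I -> 'rV[int]_n.+1)
    (b : I -> R) (r : 'rV[int]_n.+1) (h : 'rV[R]_n.+1) (g : R) :
  flat_bound R n W -> r != 0 -> (forall i, dot (a i) r <= 0) ->
  let K x := forall i, dot (map_mx intr (a i)) x <= b i in
  (exists x, K x) ->
  (forall c : 'rV[int]_n.+1, c != 0 ->
     exists x y, [/\ K x, K y & W%:R <= dot (map_mx intr c) (x - y)]) ->
  h != 0 \/ g != 0 -> exists x, [/\ int_vec x, K x & dot h x != g].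
Proof.
move=> IH r0 ar K [x0 Kx0] wide hg.
have [k [r1 [c [M' [N' [k0 rE fr']]]]]] := frame_exists r0.
have := frame_tr fr'; move: M'^T N'^T => M N fr {fr'}.
have {ar}ar i : dot (a i) r1 <= 0.
  by have := ar i; rewrite rE dotZr pmulr_rle0.
have frR := frame_map (intr : int -> R) fr.
pose K2 (y : 'rV[R]_n) := forall i, dot (a i) r1 = 0 ->
  dot (map_mx intr (a i)) (y *m map_mx intr N) <= b i.
have pK2 : ipoly K2.
  exists I, (fun i => if dot (a i) r1 == 0 then a i *m N^T else 0),
    (fun i => if dot (a i) r1 == 0 then b i else 0) => y; split=> Ky i; last first.
    by move=> ai; have := Ky i; rewrite ai eqxx dot_mulmxr map_trmx -map_mxM.
  case: ifP => [/eqP/Ky|_]; last by rewrite map_mx0 dot0l.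
  by rewrite dot_mulmxr map_trmx -map_mxM.
have KK2 x : K x -> K2 (x *m map_mx intr M).
  move=> Kx i ai; have := Kx i; rewrite -{1}(frame_ptK frR x) dotDr dotZr dot_map ai.
  by rewrite mulr0 add0r.
have K2K y : K2 y -> exists m0 : nat, forall m : nat, (m0 <= m)%N ->
    K (m%:R *: map_mx intr r1 + y *m map_mx intr N).
  move=> Ky; pose f i := `|dot (map_mx intr (a i)) (y *m map_mx intr N) - b i|.
  have fi0 i : 0 <= f i by apply: normr_ge0.
  have f0 : 0 <= \sum_i f i by apply: sumr_ge0.
  exists (Num.bound (\sum_i f i)) => m; rewrite -(ler_nat R) => /(lt_le_trans (archi_boundP f0)) fm.
  move=> i; rewrite dotDr dotZr dot_map.
  have [/eqP ai|ai] := boolP (dot (a i) r1 == 0); first by rewrite ai mulr0 add0r Ky.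
  have : dot (a i) r1 <= - 1 by rewrite -ltzD1 addNr lt_neqAle ai ar.
  rewrite -(ler_int R) => ai1.
  have : m%:R * (dot (a i) r1)%:~R <= m%:R * (-1)%:~R :> R by apply: ler_wpM2l.
  have : f i <= \sum_i f i by rewrite (bigD1 i) //= lerDl sumr_ge0.
  have := ler_norm (dot (map_mx intr (a i)) (y *m map_mx intr N) - b i).
  by rewrite -/(f i) mulrN1z; lra.
have K2_0 : exists y, K2 y by exists (x0 *m map_mx intr M); exact: KK2.
have K2_wide d : d != 0 ->
    exists x y, [/\ K2 x, K2 y & W%:R <= dot (map_mx intr d) (x - y)].
  move=> d0; have [|x [y [Kx Ky]]] := wide (d *m M^T).
    apply: contraNneq d0 => d0; have [_ _ _ NM _] := fr.
    by rewrite -[d]mulmx1 -trmx1 -NM trmx_mul mulmxA d0 mul0mx.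
  rewrite map_mxM -map_trmx -dot_mulmxr mulmxBl => wxy.
  by exists (x *m map_mx intr M), (y *m map_mx intr M); split=> //; exact: KK2.
have Kint (m : nat) y : int_vec y ->
    int_vec (m%:R *: map_mx intr r1 + y *m map_mx intr N : 'rV[R]_n.+1).
  by move=> yi; exact: (slice_int r1 N m yi).
have [hr|hr] := eqVneq (dot h (map_mx intr r1)) 0.
  have [|y [yi Ky hy]] := IH K2 pK2 K2_0 K2_wide (h *m (map_mx intr N)^T) g.
    case: hg => [h0|]; [left | by right].
    apply: contraNneq h0 => hN0; rewrite -(frame_ptK (frame_tr frR) h).
    by rewrite dotC hr hN0 /pt mul0mx scale0r addr0.
  have [m0 /(_ m0 (leqnn _)) Km] := K2K y Ky.
  exists (m0%:R *: map_mx intr r1 + y *m map_mx intr N); split=> //; first exact: Kint.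
  by rewrite dotDr dotZr hr mulr0 add0r dot_mulmxr.
(* With [h = 0] and [g = 1] the induction yields just some integer point. As [h] is not constant
   along [r1], at most one of two consecutive lifts lies on the hyperplane. *)
have [|y [yi Ky _]] := IH K2 pK2 K2_0 K2_wide 0 1; first by right; rewrite oner_eq0.
have [m0 m0P] := K2K y Ky.
pose z m : 'rV[R]_n.+1 := m%:R *: map_mx intr r1 + y *m map_mx intr N.
have [hz|hz] := eqVneq (dot h (z m0)) g; last first.
  by exists (z m0); split=> //; [exact: Kint | exact: m0P].
exists (z m0.+1); split; [exact: Kint | exact: m0P |].
apply: contraNneq hr; move: hz; rewrite /z !dotDr !dotZr mulrSr => hz e.
by apply/eqP; lra.
Qed.

(** The term [12 * W] makes the final estimate [om <= 3 * W + w / 2 < 3 * W + 3 / 4 * om]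
    contradictory. The term [9] gives the middle third of [[A, D]] length at least 3, leaving room
    for two consecutive integer levels. *)
Lemma flat_bound_bounded (R : realType) n W (K : pset R n.+1) (B : R) (h : 'rV[R]_n.+1) (g : R) :
  flat_bound R n W -> ipoly K -> (forall x, K x -> forall k, `|x 0 k| <= B) ->
  (forall c : 'rV[int]_n.+1, c != 0 ->
     exists x y, [/\ K x, K y & (12 * W + 9)%:R <= dot (map_mx intr c) (x - y)]) ->
  h != 0 \/ g != 0 -> exists x, [/\ int_vec x, K x & dot h x != g].
Proof.
move=> IH pK KB wide hg.
pose E (w : R) := exists2 c : 'rV[int]_n.+1, c != 0 &
  forall x y, K x -> K y -> dot (map_mx intr c) (x - y) <= w.
have EW w : E w -> (12 * W + 9)%:R <= w.
  by move=> [c /wide[x [y [Kx Ky le]]] /(_ x y Kx Ky)]; exact: le_trans.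
have E0 : E (B + B).
  exists (delta_mx 0 0).
    by apply/eqP => /matrixP/(_ 0 0)/eqP; rewrite !mxE.
  move=> x y Kx Ky; rewrite map_delta_mx dot_delta !mxE.
  have := KB x Kx 0; have := KB y Ky 0; rewrite !ler_norml => /andP[h1 h2] /andP[h3 h4].
  by lra.
have [||om [omE omm]] := @glb_exists R E; [by exists (B + B) | by exists (12 * W + 9)%:R |].
have omW : (12 * W + 9)%:R <= om by apply: omm.
have W0 : 0 <= W%:R :> R by apply: ler0n.
move: omW; rewrite natrD natrM => omW.
(* A direction within the factor 3/2 of the infimum is enough: half its width is below
   [3 / 4 * om]. *)
have [w [c0 c0n cw] wom] : exists2 w, E w & w < 3 / 2 * om.
  apply: contrapT => nw; have : 3 / 2 * om <= om; last lra.
  by apply: omm => w Ew; rewrite leNgt; apply/negP => lt; apply: nw; exists w.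
have [k [c [u [N [M [k0 cE fr]]]]]] := frame_exists c0n.
have frR := frame_map (intr : int -> R) fr.
have cn0 : c != 0 by apply: contraNneq c0n => z; rewrite cE z scaler0.
have [x1 [y1 [Kx1 Ky1 _]]] := wide c cn0.
have {}cw x y : K x -> K y -> dot (map_mx intr c) (x - y) <= w.
  move=> Kx Ky; have := cw x y Kx Ky; have := cw x x Kx Kx.
  rewrite subrr dot0r cE map_mxZ dotZl => w0 kw.
  have [lt0|ge0] := ltP (dot (map_mx intr c) (x - y)) 0; first exact: le_trans (ltW lt0) w0.
  by apply: le_trans kw; apply: ler_peMl => //; rewrite -[1]/(1%:~R) ler_int -gtz0_ge1.
have [||A [KA Ainf]] := @glb_exists R (fun t => exists2 x, K x & t = dot (map_mx intr c) x).
- by exists (dot (map_mx intr c) x1), x1.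
- exists (dot (map_mx intr c) x1 - w) => _ [x Kx ->].
  by have := cw _ _ Kx1 Kx; rewrite dotBr; lra.
have [||D [KD Dsup]] := @lub_exists R (fun t => exists2 x, K x & t = dot (map_mx intr c) x).
- by exists (dot (map_mx intr c) x1), x1.
- exists (dot (map_mx intr c) x1 + w) => _ [x Kx ->].
  by have := cw _ _ Kx Kx1; rewrite dotBr; lra.
have {}KA x : K x -> A <= dot (map_mx intr c) x by move=> Kx; apply: KA; exists x.
have {}KD x : K x -> dot (map_mx intr c) x <= D by move=> Kx; apply: KD; exists x.
have {}Ainf t : (forall x, K x -> t <= dot (map_mx intr c) x) -> t <= A.
  by move=> tP; apply: Ainf => _ [x Kx ->]; exact: tP.
have {}Dsup t : (forall x, K x -> dot (map_mx intr c) x <= t) -> D <= t.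
  by move=> tP; apply: Dsup => _ [x Kx ->]; exact: tP.
have DAw : D - A <= w.
  rewrite lerBlDr -lerBlDl; apply: Ainf => y Ky; rewrite lerBlDl.
  by apply: Dsup => x Kx; have := cw _ _ Kx Ky; rewrite dotBr; lra.
have omDA : om <= D - A.
  apply: omE; exists c => // x y Kx Ky; rewrite dotBr.
  by have := KA y Ky; have := KD x Kx; lra.
pose j0 := Num.ceil (A + (D - A) / 3).
have /andP[] := ceil_itv (A + (D - A) / 3); rewrite -/j0 intrD => j0l j0u.
pose u' : 'rV[R]_n.+1 := map_mx intr u.
pose N' : 'M[R]_(n, n.+1) := map_mx intr N.
(* The hyperplane restricted to the layer must stay nontrivial. If [h] is constant on layers, then
   either it vanishes and [g != 0], or it equals [g] on at most one of the levels [j0] and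
   [j0 + 1]. *)
have [j [jl ju hj]] : exists j : int, [/\ A + (D - A) / 3 <= j%:~R,
    j%:~R <= A + (D - A) / 3 + 2 & h *m N'^T != 0 \/ g - j%:~R * dot h u' != 0].
  have [hN|hN] := eqVneq (h *m N'^T) 0; last by exists j0; split; [lra | lra | left].
  have [hu|hu] := eqVneq (dot h u') 0.
    exists j0; split; [lra | lra | right]; rewrite hu mulr0 subr0.
    case: hg => // /negP[]; rewrite -(frame_ptK (frame_tr frR) h).
    by rewrite dotC hu hN /pt mul0mx scale0r addr0.
  have [hj|hj] := eqVneq (g - j0%:~R * dot h u') 0; last by exists j0; split; [lra|lra|right].
  exists (j0 + 1); rewrite intrD; split; [lra | lra | right].
  by apply: contraNneq hu => e; apply/eqP; lra.
have cvx x y s t := @ipoly_convex R _ K x y s t pK.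
have [Aj jD] : A < j%:~R /\ j%:~R < D by split; lra.
have up : exists2 x, K x & j%:~R < dot (map_mx intr c) x.
  apply: contrapT => nx; suff : D <= j%:~R by rewrite leNgt jD.
  by apply: Dsup => x Kx; rewrite leNgt; apply/negP => jx; apply: nx; exists x.
have dn : exists2 x, K x & dot (map_mx intr c) x < j%:~R.
  apply: contrapT => nx; suff : j%:~R <= A by rewrite leNgt Aj.
  by apply: Ainf => x Kx; rewrite leNgt; apply/negP => jx; apply: nx; exists x.
have [z0 Kz0 cz0] : exists2 z, K z & dot (map_mx intr c) z = j%:~R.
  have [[x Kx jx] [y Ky yj]] := (up, dn).
  by have [s [t [_ _ Kz cz _]]] := slice_crossing cvx Kx Ky yj jx;
    exists ((s + t)^-1 *: (s *: x + t *: y)).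
have slice0 := slice_proj fr Kz0 cz0.
have wideS d : d != 0 -> exists x y, [/\ slice K u N j%:~R x, slice K u N j%:~R y
    & W%:R <= dot (map_mx intr d) (x - y)].
  move=> d0; apply: contrapT => narrow.
  have lt x y : slice K u N j%:~R x -> slice K u N j%:~R y -> dot (map_mx intr d) (x - y) <= W%:R.
    move=> Sx Sy; rewrite ltW // ltNge; apply/negP => le; apply: narrow; by exists x, y.
  pose y0 := z0 *m map_mx intr M.
  have [||al [Sal alm]] := @glb_exists R
    (fun t => exists2 x, slice K u N j%:~R x & t = dot (map_mx intr d) x).
  - by exists (dot (map_mx intr d) y0), y0.
  - exists (dot (map_mx intr d) y0 - W%:R) => _ [x Kx ->].
    by have := lt _ _ slice0 Kx; rewrite dotBr; lra.
  have [||be [Sbe bem]] := @lub_exists R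
    (fun t => exists2 x, slice K u N j%:~R x & t = dot (map_mx intr d) x).
  - by exists (dot (map_mx intr d) y0), y0.
  - exists (dot (map_mx intr d) y0 + W%:R) => _ [x Kx ->].
    by have := lt _ _ Kx slice0; rewrite dotBr; lra.
  have baW : be - al <= W%:R.
    rewrite lerBlDr -lerBlDl; apply: alm => _ [y Ky ->]; rewrite lerBlDl.
    by apply: bem => _ [x Kx ->]; have := lt _ _ Kx Ky; rewrite dotBr; lra.
  have [||x Kx cx|t tP] := @shear R _ K cvx (map_mx intr c) (map_mx intr (d *m M^T)) A D j%:~R al be
    KA Ainf KD Dsup Aj jD; try lra.
    have := slice_proj fr Kx cx; rewrite map_mxM -map_trmx -dot_mulmxr => Sx.
    by apply/andP; split; [apply: Sal | apply: Sbe]; exists (x *m map_mx intr M).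
  (* [t'] is an integer nearest to [t]; the replacement adds at most half of [w] to the width. *)
  pose t' := Num.floor (t + 1 / 2).
  have /andP[] := floor_itv (t + 1 / 2); rewrite -/t' intrD => t'l t'u.
  have : E (3 * W%:R + w / 2).
    exists (d *m M^T + t' *: c).
      apply: contraNneq d0 => e0; have [_ Nc _ NM _] := fr.
      rewrite -[d]mulmx1 -trmx1 -NM trmx_mul mulmxA.
      have -> : d *m M^T = - t' *: c by apply/eqP; rewrite scaleNr -addr_eq0 e0.
      by rewrite -scalemxAl -[c]trmxK -trmx_mul Nc trmx0 scaler0.
    move=> x y Kx Ky; rewrite map_mxD map_mxZ.
    have := tP x y Kx Ky; have := cw x y Kx Ky; have := cw y x Ky Kx.
    rewrite -opprB dotNr !(dotDl _ _ (x - y)) !(dotZl _ _ (x - y)).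
    move: (dot _ (x - y)) (dot _ (x - y)) => p q; nra.
  by move=> /omE; lra.
have [y [yi Sy hy]] := IH (slice K u N j%:~R) (ipoly_slice u N _ pK) (ex_intro _ _ slice0) wideS
  (h *m N'^T) (g - j%:~R * dot h u') hj.
exists (pt u' N' j%:~R y); split=> //; first exact: slice_int.
by apply: contraNneq hy => <-; rewrite dotDr dotZr dot_mulmxr addrC addKr.
Qed.

Lemma flatness n : exists W : nat, forall R : realType, flat_bound R n W.
Proof.
elim: n => [|n [W IH]].
  (* In dimension 0 only [g != 0] is possible, so the single point qualifies. *)
  exists 0%N => R K _ [x Kx] _ h g hg; exists x; split=> //; first by case.
  case: hg => [/negP[]|]; first by apply/eqP/rowP; case.
  by rewrite /dot big_ord0 eq_sym.
exists (12 * W + 9)%N => R K pK K0 wide h g hg.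
have [I [a [b Kab]]] := pK.
have [[B KB]|[r [r0 ar]]] := ipoly_recession a b.
  by apply: (flat_bound_bounded (IH R) pK _ wide hg) => x /Kab; exact: KB.
have [|c /wide[x [y [/Kab Kx /Kab Ky xy]]]|x [xi Kx hx]] :=
  flat_bound_unbounded (b := b) (IH R) r0 ar _ _ hg.
- by have [x /Kab Kx] := K0; exists x.
- exists x, y; split=> //; apply: le_trans xy; rewrite ler_nat.
  by rewrite -[X in (X <= _)%N]addn0 leq_add // leq_pmull.
- by exists x; split=> //; apply/Kab.
Qed.

(** * Thin directions orthogonal to the affine hull *)
Section Thin.
Variable R : realType.

Lemma int_vecZ n (k : nat) (x : 'rV[R]_n) : int_vec x -> int_vec (k%:R *: x).
Proof. by move=> xi i; rewrite mxE rpredM // natr_int. Qed.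

Lemma int_vecD n (x y : 'rV[R]_n) : int_vec x -> int_vec y -> int_vec (x + y).
Proof. by move=> xi yi i; rewrite mxE rpredD. Qed.

Lemma int_vecM m n (x : 'rV[R]_m) (M : 'M[int]_(m, n)) :
  int_vec x -> int_vec (x *m map_mx intr M).
Proof.
by move=> /int_vecP[v ->]; apply/int_vecP; exists (v *m M); rewrite map_mxM.
Qed.

Lemma int_vec_dot n (c : 'rV[int]_n) (x : 'rV[R]_n) : int_vec x ->
  exists m : int, dot (map_mx intr c) x = m%:~R.
Proof. by move=> /int_vecP[v ->]; exists (dot c v); rewrite dot_map. Qed.

(* [0] lies in the relative interior of the convex hull of [S], in dual form. *)
Definition balanced n (S : pset R n) := forall d : 'rV[R]_n,
  (forall p, S p -> 0 <= dot d p) -> forall p, S p -> dot d p = 0.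

(** The points of [S] may have denominator [D], because the induction replaces them by the points
    where segments between them cross a slice. *)
Definition thin_bound n (D W : nat) := forall (K S : pset R n) (h : 'rV[R]_n),
  ipoly K -> K 0 -> (forall p, S p -> K p) ->
  (forall p, S p -> int_vec (D%:R *: p)) -> balanced S -> h != 0 ->
  (forall p, S p -> dot h p = 0) ->
  (forall p, int_vec p -> K p -> dot h p = 0) ->
  exists c : 'rV[int]_n, [/\ c != 0, forall p, S p -> dot (map_mx intr c) p = 0
    & forall x, K x -> `|dot (map_mx intr c) x| <= W%:R].

Lemma balanced_signs n (S : pset R n) c p0 : balanced S -> S p0 -> dot c p0 != 0 ->
  (exists2 p, S p & 0 < dot c p) /\ (exists2 q, S q & dot c q < 0).
Proof.
move=> bS Sp0 cp0; split; apply: contrapT => none.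
  have : dot (- c) p0 = 0.
    apply: bS => // p Sp; rewrite dotNl oppr_ge0 leNgt; apply/negP => lt.
    by apply: none; exists p.
  by rewrite dotNl => /eqP; rewrite oppr_eq0 (negbTE cp0).
have /eqP : dot c p0 = 0.
  by apply: bS => // p Sp; rewrite leNgt; apply/negP => lt; apply: none; exists p.
by rewrite (negbTE cp0).
Qed.

(** * Slicing a balanced set through the origin *)

Section Slice.
Variables (n : nat) (D w : nat) (K S : pset R n.+1).
Variables (c u : 'rV[int]_n.+1) (N : 'M[int]_(n, n.+1)) (M : 'M[int]_(n.+1, n)).
Hypotheses (D0 : (0 < D)%N) (fr : frame c u N M).
Hypothesis pK : ipoly K.
Hypothesis SK : forall p, S p -> K p.
Hypothesis SD : forall p, S p -> int_vec (D%:R *: p).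
Hypothesis bS : balanced S.
Hypothesis cw : forall x, K x -> `|dot (map_mx intr c) x| <= w%:R.

Let cR : 'rV[R]_n.+1 := map_mx intr c.
Let frR : frame cR (map_mx intr u) (map_mx intr N) (map_mx intr M) := frame_map intr fr.
Let emb (y : 'rV[R]_n) : 'rV[R]_n.+1 := pt (map_mx intr u) (map_mx intr N) 0 y.
(** Multiplying a crossing point by [D * (l + m)], with positive integers [l, m <= D * w], makes it
    integral; every such [l + m] divides the factorial of [2 * D * w]. *)
Let D1 := (D * (2 * D * w)`!)%N.

(** Points where segments between two points of [S] meet the hyperplane [c x = 0], in frame
    coordinates; segments already suffice to inherit the balance of [S]. *)
Definition thin_slice : pset R n := fun y =>
  int_vec (D1%:R *: y) /\ exists p q s t,
    [/\ S p, S q, 0 <= s, 0 <= t & s + t = 1 /\ emb y = s *: p + t *: q].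

Lemma S_int p : S p -> exists m : int, D%:R * dot cR p = m%:~R.
Proof. by move=> /SD /(int_vec_dot c); rewrite dotZr. Qed.

Lemma D_gt0 : 0 < D%:R :> R. Proof. by rewrite ltr0n. Qed.

Lemma S_pos p : S p -> 0 < dot cR p -> exists m : nat,
  [/\ D%:R * dot cR p = m%:R, (0 < m)%N & (m <= D * w)%N].
Proof.
move=> Sp cp; have [m mE] := S_int Sp.
have m0 : 0 < m by rewrite -(ltr0z R) -mE mulr_gt0 ?D_gt0.
case: m m0 mE => // m m0 mE; have {}mE : D%:R * dot cR p = m%:R by exact: mE.
exists m; split=> //; rewrite -(ler_nat R) -mE natrM ler_pM2l ?D_gt0 //.
exact: le_trans (ler_norm _) (cw (SK Sp)).
Qed.

Lemma S_neg p : S p -> dot cR p < 0 -> exists m : nat,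
  [/\ D%:R * - dot cR p = m%:R, (0 < m)%N & (m <= D * w)%N].
Proof.
move=> Sp cp; have [m mE] := S_int Sp.
have m0 : 0 < - m by rewrite -(ltr0z R) mulrNz -mE -mulrN mulr_gt0 ?D_gt0 // oppr_gt0.
case E: (- m) m0 => [k|//] k0; exists k.
have kE : D%:R * - dot cR p = k%:R by rewrite mulrN mE -mulrNz E.
split=> //; rewrite -(ler_nat R) -kE natrM ler_pM2l ?D_gt0 //.
by apply: le_trans (cw (SK Sp)); rewrite -normrN ler_norm.
Qed.

Lemma thin_slice0 p : S p -> dot cR p = 0 -> thin_slice (p *m map_mx intr M).
Proof.
move=> Sp cp; split.
  rewrite scalemxAl; apply: int_vecM.
  by rewrite /D1 mulnC natrM -scalerA; apply/int_vecZ/SD.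
exists p, p, 1, 0; split=> //.
by rewrite scale1r scale0r !addr0 /emb -{1}cp (frame_ptK frR).
Qed.

Lemma thin_slice_cross p q : S p -> S q -> 0 < dot cR p -> dot cR q < 0 ->
  thin_slice (((- dot cR q + dot cR p)^-1 *: (- dot cR q *: p + dot cR p *: q)) *m map_mx intr M).
Proof.
move=> Sp Sq cp cq; have [m [mE m0 mw]] := S_pos Sp cp; have [l [lE l0 lw]] := S_neg Sq cq.
set z := _ *: (_ + _).
have st0 : 0 < - dot cR q + dot cR p by rewrite addr_gt0 // oppr_gt0.
have st1 : - dot cR q + dot cR p != 0 by rewrite gt_eqF.
have cz : dot cR z = 0 by rewrite /z !dotZDE; apply: (mulfI st1); rewrite mulVKf //; ring.
split.
  rewrite scalemxAl; apply: int_vecM.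
  have /dvdnP[k kE] : (l + m %| (2 * D * w)`!)%N.
    by rewrite dvdn_fact // addn_gt0 l0 /= -mulnA mul2n -addnn leq_add.
  have -> : D1%:R *: z = k%:R *: (l%:R *: (D%:R *: p) + m%:R *: (D%:R *: q)).
    rewrite /z /D1 kE 2!natrM natrD -lE -mE !scalerDr !scalerA -!mulrDr.
    by congr (_ *: _ + _ *: _); field.
  by apply/int_vecZ/int_vecD; apply/int_vecZ/SD.
exists p, q, ((- dot cR q + dot cR p)^-1 * - dot cR q), ((- dot cR q + dot cR p)^-1 * dot cR p).
split=> //.
- by rewrite mulr_ge0 ?invr_ge0 ?ltW // oppr_gt0.
- by rewrite mulr_ge0 ?invr_ge0 ?ltW.
- by rewrite -mulrDr mulVf // -!scalerA -scalerDr /emb -{1}cz (frame_ptK frR).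
Qed.

Lemma dot_lift (d : 'rV[R]_n) x :
  dot (d *m (map_mx intr M)^T) x = dot d (x *m map_mx intr M).
Proof. by rewrite dot_mulmxr. Qed.

Lemma thin_slice_cross_dot d p q : (forall y, thin_slice y -> 0 <= dot d y) ->
  S p -> S q -> 0 < dot cR p -> dot cR q < 0 ->
  0 <= - dot cR q * dot d (p *m map_mx intr M) + dot cR p * dot d (q *m map_mx intr M).
Proof.
move=> dS Sp Sq cp cq; have := dS _ (thin_slice_cross Sp Sq cp cq).
by rewrite -scalemxAl mulmxDl -!scalemxAl !dotZDE pmulr_rge0 // invr_gt0 addr_gt0 // oppr_gt0.
Qed.

(** A functional [d] nonnegative on the slice extends to [d - t * c], nonnegative on [S]: crossing
    points show that some [t] separates the ratios [d / c] on the two sides. Balance of [S] makes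
    the extension vanish on [S], hence [d] on the slice. *)
Lemma thin_slice_balanced p0 : S p0 -> dot cR p0 != 0 -> balanced thin_slice.
Proof.
move=> Sp0 cp0 d dS.
have [[pp Spp cpp] [pm Spm cpm]] := balanced_signs bS Sp0 cp0.
pose dl p := dot d (p *m map_mx intr M).
have cross p q : S p -> S q -> 0 < dot cR p -> dot cR q < 0 -> dl q / dot cR q <= dl p / dot cR p.
  move=> Sp Sq cp cq; have := thin_slice_cross_dot dS Sp Sq cp cq; rewrite -!/(dl _) => h.
  rewrite ler_pdivlMr // mulrAC ler_ndivrMr //; lra.
have [||t [tl tm]] := @glb_exists R
    (fun t => exists p, [/\ S p, 0 < dot cR p & t = dl p / dot cR p]).
- by exists (dl pp / dot cR pp), pp.
- by exists (dl pm / dot cR pm) => _ [p [Sp cp ->]]; exact: cross.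
have eS p : S p -> 0 <= dot (d *m (map_mx intr M)^T - t *: cR) p.
  move=> Sp; rewrite dotBl dotZl dot_lift subr_ge0 -/(dl p).
  have [cp|cp|cp] := ltgtP (dot cR p) 0.
  - have : dl p / dot cR p <= t by apply: tm => _ [q [Sq cq ->]]; exact: cross.
    by rewrite ler_ndivrMr.
  - have : t <= dl p / dot cR p by apply: tl; exists p.
    by rewrite ler_pdivlMr.
  - by rewrite cp mulr0; apply/dS/thin_slice0.
move=> y [_ [p [q [a [b [Sp Sq _ _ [_ yE]]]]]]].
have e0 := bS eS.
have := frame_dot_lift frR d 0 y; rewrite -/(emb y) yE => <-.
have : dot cR (emb y) = 0 by apply: (frame_dot_pt frR).
rewrite yE; move: (e0 p Sp) (e0 q Sq); rewrite !dotZDE => /eqP; rewrite subr_eq0 => /eqP ->.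
by move=> /eqP; rewrite subr_eq0 => /eqP -> cy; rewrite mulrCA [b * _]mulrCA -mulrDr cy mulr0.
Qed.

Lemma thin_slice_sub y : thin_slice y -> slice K u N 0 y.
Proof.
move=> [_ [p [q [a [b [Sp Sq a0 b0 [ab yE]]]]]]].
by rewrite /slice -/(emb y) yE; apply: ipoly_convex => //; apply: SK.
Qed.

(** [e] is extended by the multiple of [c] that makes it vanish at [pp], with denominators cleared;
    crossing points then force it to vanish on all of [S]. To bound it at [x], one moves to the
    level [c x = 0] towards a point of [S], where [c'] is zero. *)
Lemma thin_lift (W : nat) (e : 'rV[int]_n) p0 : S p0 -> dot cR p0 != 0 -> e != 0 ->
  (forall y, thin_slice y -> dot (map_mx intr e) y = 0) ->
  (forall y, slice K u N 0 y -> `|dot (map_mx intr e) y| <= W%:R) ->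
  exists c' : 'rV[int]_n.+1, [/\ c' != 0, forall p, S p -> dot (map_mx intr c') p = 0
    & forall x, K x -> `|dot (map_mx intr c') x| <= (D * w * W * (1 + D * w))%:R].
Proof.
move=> Sp0 cp0 e0 eS eW.
have [[pp Spp cpp] [pm Spm cpm]] := balanced_signs bS Sp0 cp0.
have [m [mE m0 mw]] := S_pos Spp cpp.
pose el x := dot (map_mx intr e : 'rV[R]_n) (x *m map_mx intr M).
have [a aE] : exists a : int, D%:R * el pp = a%:~R.
  by have [a aE] := int_vec_dot e (int_vecM M (SD Spp)); exists a; rewrite -aE -scalemxAl dotZr.
pose c' := m%:Z *: (e *m M^T) - a *: c.
have c'E x : dot (map_mx intr c') x = D%:R * (dot cR pp * el x - el pp * dot cR x).
  rewrite /c' map_mxB !map_mxZ map_mxM -map_trmx dotBl !dotZl dot_lift -/(el x) /= -aE.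
  have -> : m%:~R = D%:R * dot cR pp by exact: esym.
  by ring.
have ratio p q : S p -> S q -> 0 < dot cR p -> dot cR q < 0 ->
    dot cR q * el p = dot cR p * el q.
  move=> Sp Sq cp cq.
  have h1 := @thin_slice_cross_dot (map_mx intr e) p q _ Sp Sq cp cq.
  have h2 := @thin_slice_cross_dot (- map_mx intr e) p q _ Sp Sq cp cq.
  move: h1 h2; rewrite !dotNl -!/(el _) => h1 h2.
  have {}h1 : 0 <= - dot cR q * el p + dot cR p * el q by apply: h1 => y /eS ->.
  have {}h2 : 0 <= - dot cR q * - el p + dot cR p * - el q.
    by apply: h2 => y /eS; rewrite dotNl => ->; rewrite oppr0.
  by apply/eqP; rewrite eq_le; apply/andP; split; lra.
have c'S p : S p -> dot (map_mx intr c') p = 0.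
  move=> Sp; rewrite c'E.
  have [cp|cp|cp] := ltgtP (dot cR p) 0.
  - by rewrite -(ratio pp p) // [el pp * _]mulrC subrr mulr0.
  (* Two points on the positive side are compared through [pm] on the negative one. *)
  - have rp := ratio _ _ Sp Spm cp cpm; have rpp := ratio _ _ Spp Spm cpp cpm.
    apply/eqP; rewrite mulf_eq0; apply/orP; right.
    have /lt_eqF/negbT/mulfI cm := cpm; apply/eqP/cm; rewrite mulr0 mulrBr.
    rewrite [_ * (dot cR pp * _)]mulrCA rp [_ * (el pp * _)]mulrA rpp; ring.
  - by rewrite cp mulr0 subr0 /el eS ?mulr0 //; apply: thin_slice0.
have c'0 : c' != 0.
  apply: contraNneq e0 => c'0; have [_ Nc _ NM _] := fr.
  have : c' *m N^T = 0 by rewrite c'0 mul0mx.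
  rewrite /c' mulmxBl -!scalemxAl -mulmxA -trmx_mul NM trmx1 mulmx1.
  rewrite -{1}[c]trmxK -trmx_mul Nc trmx0 scaler0 subr0 => /rowP me.
  apply/eqP/rowP=> k; have := me k; rewrite !mxE => /eqP; rewrite mulf_eq0.
  by rewrite -[m%:Z == 0]/(m == 0%N) (gtn_eqF m0) => /eqP.
have c'W z : K z -> dot cR z = 0 -> `|dot (map_mx intr c') z| <= (D * w * W)%:R.
  move=> Kz cz; rewrite c'E cz mulr0 subr0 mulrA mE normrM normr_nat natrM.
  apply: ler_pM => //; first by rewrite ler_nat.
  by apply: eW; apply: (slice_proj fr).
exists c'; split=> // x Kx.
(* Since [c'] vanishes at [p], its value at [x] is [(s + t) / s] times that at the crossing point,
   and [(s + t) / s <= 1 + D * w]. *)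
have cut s t p : S p -> 0 < s -> 1 <= D%:R * s -> 0 <= t -> t <= w%:R ->
    K ((s + t)^-1 *: (s *: x + t *: p)) -> dot cR ((s + t)^-1 *: (s *: x + t *: p)) = 0 ->
    `|dot (map_mx intr c') x| <= (D * w * W * (1 + D * w))%:R.
  move=> Sp s0 Ds t0 tw Kz cz; have := c'W _ Kz cz.
  rewrite dotZr dotDr !dotZr (c'S p Sp) mulr0 addr0.
  have st : 0 < s + t by rewrite ltr_wpDr.
  rewrite 2!normrM normfV (gtr0_norm st) (gtr0_norm s0) ler_pdivrMl // -ler_pdivlMl // => h.
  apply: (le_trans h); rewrite ler_pdivrMl // [(D * w * W * _)%:R]natrM.
  rewrite [leRHS]mulrCA [leLHS]mulrC ler_wpM2l //.
  have -> : (1 + D * w)%:R = 1 + D%:R * w%:R :> R by rewrite natrD natrM.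
  have : w%:R * 1 <= w%:R * (D%:R * s) by apply: ler_wpM2l.
  lra.
have h1 : `|dot (map_mx intr c') x| <= (D * w * W)%:R ->
    `|dot (map_mx intr c') x| <= (D * w * W * (1 + D * w))%:R.
  by move=> /le_trans; apply; rewrite ler_nat leq_pmulr.
have cxw := cw Kx.
have [cx|cx|cx] := ltgtP (dot cR x) 0; last exact/h1/c'W.
- have [s [t [s0 t0 Kz cz [sE tE]]]] :=
    slice_crossing (fun x y s t => @ipoly_convex R _ K x y s t pK)
    (SK Spp) Kx cx cpp.
  rewrite addrC [X in _ *: X]addrC in Kz cz.
  have [k [kE k0 _]] := S_pos Spp cpp.
  apply: (cut t s pp) => //; first by rewrite tE subr0 kE ler1n.
    exact: ltW.
  by rewrite sE sub0r; apply: le_trans cxw; rewrite -normrN ler_norm.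
- have [s [t [s0 t0 Kz cz [sE tE]]]] :=
    slice_crossing (fun x y s t => @ipoly_convex R _ K x y s t pK)
    Kx (SK Spm) cpm cx.
  have [k [kE k0 _]] := S_neg Spm cpm.
  apply: (cut s t pm) => //; first by rewrite sE sub0r kE ler1n.
    exact: ltW.
  by rewrite tE subr0; apply: le_trans cxw; rewrite ler_norm.
Qed.


End Slice.
End Thin.

Lemma thin n : forall D, (0 < D)%N -> exists W, forall R, thin_bound R n D W.
Proof.
elim: n => [|n IH] D D0.
  by exists 0%N => R K S h _ _ _ _ _ /negP[]; apply/eqP/rowP; case.
have [w flat] := flatness n.+1.
have [W thinW] := IH (D * (2 * D * w)`!)%N (ltac:(by rewrite muln_gt0 D0 fact_gt0)).
(* The first summand serves a flat direction already orthogonal to [S], the second a direction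
   lifted from the slice. *)
exists (w + D * w * W * (1 + D * w))%N => R K S h pK K0 SK SD bS h0 hS hK.
have [c0 c0n cw] : exists2 c : 'rV[int]_n.+1, c != 0 &
    forall x y, K x -> K y -> dot (map_mx intr c) (x - y) < w%:R.
  apply: contrapT => wide; have [||x [xi Kx]] := flat R K pK _ _ h 0 (or_introl h0).
  - by exists 0.
  - move=> c cn; apply: contrapT => nxy; apply: wide; exists c => // x y Kx Ky.
    by rewrite ltNge; apply/negP => le; apply: nxy; exists x, y.
  - by rewrite hK ?eqxx.
have [k [c [u [N [M [k0 cE fr]]]]]] := frame_exists c0n.
have {}cw x : K x -> `|dot (map_mx intr c) x| <= w%:R.
  move=> Kx; have := cw x 0 Kx K0; have := cw 0 x K0 Kx.
  rewrite subr0 sub0r dotNr cE map_mxZ dotZl => h1 h2.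
  apply: (@le_trans _ _ `|k%:~R * dot (map_mx intr c) x|).
    rewrite normrM; apply: ler_peMl => //.
    by rewrite gtr0_norm ?ltr0z // -[1]/(1%:~R) ler_int -gtz0_ge1.
  by rewrite ler_norml; apply/andP; split; lra.
have cn0 : c != 0 by apply: contraNneq c0n => z; rewrite cE z scaler0.
have [cS|] := EM (forall p, S p -> dot (map_mx intr c) p = 0).
  exists c; split=> // x /cw /le_trans; apply.
  by rewrite ler_nat leq_addr.
move=> /existsNP[p0 /not_implyP[Sp0 /eqP cp0]].
have frR := frame_map (intr : int -> R) fr.
(* Otherwise [h] would be a nonzero multiple of [c], yet [h] vanishes at [p0] and [c] does not. *)
have hN0 : h *m (map_mx intr N)^T != 0.
  apply: contraNneq h0 => hN; rewrite -(frame_ptK (frame_tr frR) h) hN /pt mul0mx addr0.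
  have := hS p0 Sp0; rewrite -{1}(frame_ptK (frame_tr frR) h) hN /pt mul0mx addr0 dotZl.
  by move=> /eqP; rewrite mulf_eq0 (negbTE cp0) orbF => /eqP ->; rewrite scale0r.
have sliceE y : pt (map_mx intr u) (map_mx intr N) 0 y = y *m map_mx intr N :> 'rV[R]_n.+1.
  by rewrite /pt scale0r add0r.
have [||||||e [e0 eS eW]] := thinW R (slice K u N 0) (thin_slice D w S u N)
  (h *m (map_mx intr N)^T) (ipoly_slice u N 0 pK) _ _ _ _ hN0.
- by rewrite /slice sliceE mul0mx.
- by move=> y; apply: thin_slice_sub.
- by move=> y [].
- exact: (thin_slice_balanced D0 fr SK SD bS cw Sp0 cp0).
- move=> y [_ [p [q [s [t [Sp Sq _ _ [_]]]]]]]; rewrite -dot_mulmxr sliceE => ->.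
  by rewrite dotDr !dotZr !hS // !mulr0 addr0.
- move=> y yi Ky; rewrite -dot_mulmxr -sliceE; apply: hK => //.
  exact: (slice_int u N 0 yi).
have [c' [c'0 c'S c'W]] := thin_lift D0 fr pK SK SD bS cw Sp0 cp0 e0 eS eW.
exists c'; split=> // x /c'W /le_trans; apply.
by rewrite ler_nat leq_addl.
Qed.

(* The nonempty layers of [Q] in a thin direction are cut off one at a time, each
   of them in the number of rounds that empties an integer-free slice. *)
Lemma integer_free_rank n : exists th, forall (R : realType) (Q : pset R n), ipoly Q ->
  (forall x, int_vec x -> ~ Q x) -> forall x, ~ cg_iter th Q x.
Proof.
elim: n => [|n [th IH]].
  exists 0%N => R Q _ Q0 x Qx; apply: (Q0 x) => //; by case.
have [W flat] := flatness n.+1.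
exists ((2 * W + 2) * th.+1)%N => R Q pQ Q0 x Qx.
have Qx0 := cg_iter_base Qx.
have [c0 c0n cw] : exists2 c : 'rV[int]_n.+1, c != 0 &
    forall x y, Q x -> Q y -> dot (map_mx intr c) (x - y) < W%:R.
  apply: contrapT => wide; have [|||y [yi Qy _]] := flat R Q pQ _ _ 0 1.
  - by exists x.
  - move=> c cn; apply: contrapT => nxy; apply: wide; exists c => // z y Qz Qy.
    by rewrite ltNge; apply/negP => le; apply: nxy; exists z, y.
  - by right; rewrite oner_eq0.
  - exact: Q0 Qy.
have [k [c [u [N [M [k0 cE fr]]]]]] := frame_exists c0n.
have {}cw y z : Q y -> Q z -> dot (map_mx intr c) (y - z) <= W%:R.
  move=> Qy Qz; have := cw y z Qy Qz; rewrite cE map_mxZ dotZl => h.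
  have [lt0|ge0] := ltP (dot (map_mx intr c) (y - z)) 0.
    by apply: le_trans (ltW lt0) _.
  apply: le_trans (ltW h); apply: ler_peMl => //.
  by rewrite -[1]/(1%:~R) ler_int -gtz0_ge1.
(* [j] bounds [c] on [Q] and is less than [c x + W + 1], so removing [2 * W + 2] layers would push
   [c x] strictly below itself. *)
pose j := Num.ceil (dot (map_mx intr c) x + W%:R).
have /andP[] := ceil_itv (dot (map_mx intr c) x + W%:R); rewrite -/j intrD => ju jl.
have : dot (map_mx intr c) x <= (j - (2 * W + 2)%:Z)%:~R.
  apply: (cg_layers fr (IH R) pQ _ _ Qx) => [y Qy|y yi /(Q0 y yi)//].
  by have := cw y x Qy Qx0; rewrite dotBr; lra.
rewrite intrB -[(2 * W + 2)%:Z%:~R]/((2 * W + 2)%:R) natrD natrM.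
have : 0 <= W%:R :> R by []. lra.
Qed.

(** [thin] with [D = 1] bounds the layers on either side of [c x = 0] by [W], and the same
    [W * th.+1] rounds peel both sides. What remains lies in [c x = 0], where [be] further rounds
    act within the slice. *)
Lemma balanced_rank n : exists be, forall (R : realType) (Q : pset R n), ipoly Q -> Q 0 ->
  balanced (fun x => int_vec x /\ Q x) ->
  forall h, (forall x, int_vec x -> Q x -> dot h x = 0) ->
  forall x, cg_iter be Q x -> dot h x = 0.
Proof.
elim: n => [|n [be IH]].
  by exists 0%N => R Q _ _ _ h _ x _; rewrite /dot big_ord0.
have [W thinW] := thin n.+1 (ltn0Sn 0).
have [th kill] := integer_free_rank n.
exists (be + W * th.+1)%N => R Q pQ Q0 bQ h hQ x.
have [->|h0] := eqVneq h 0; first by rewrite dot0l.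
have [||||c0 [c0n c0Q c0W]] := thinW R Q (fun x => int_vec x /\ Q x) h pQ Q0 _ _ bQ h0.
- by move=> p [].
- by move=> p [pi _]; rewrite scale1r.
- by move=> p [pi Qp]; apply: hQ.
- exact: hQ.
have [k [c [u [N [M [k0 cE fr]]]]]] := frame_exists c0n.
have kR : 0 < k%:~R :> R by rewrite ltr0z.
have cQ p : int_vec p -> Q p -> dot (map_mx intr c) p = 0.
  move=> pi Qp; have := c0Q p (conj pi Qp); rewrite cE map_mxZ dotZl => /eqP.
  by rewrite mulf_eq0 gt_eqF //= => /eqP.
have cW y : Q y -> `|dot (map_mx intr c) y| <= W%:R.
  move=> /c0W /(le_trans _); apply; rewrite cE map_mxZ dotZl normrM; apply: ler_peMl => //.
  by rewrite gtr0_norm // -[1]/(1%:~R) ler_int -gtz0_ge1.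
pose k1 := (W * th.+1)%N; pose Q1 := cg_iter k1 Q.
have pQ1 : ipoly Q1 by apply: ipoly_cg_iter.
have c1 y : Q1 y -> dot (map_mx intr c) y = 0.
  move=> Qy; apply/eqP; rewrite eq_le; apply/andP; split.
    have := @cg_layers R n c u N M fr th (kill R) W Q W%:Z y pQ; rewrite subrr; apply=> //.
      by move=> v /cW; apply: le_trans; exact: ler_norm.
    by move=> v vi /(cQ v vi) ->.
  have := @cg_layers R n _ _ N M (frame_opp fr) th (kill R) W Q W%:Z y pQ.
  rewrite subrr map_mxN dotNl oppr_le0; apply=> //.
    by move=> v /cW; apply: le_trans; rewrite dotNl -normrN; exact: ler_norm.
  by move=> v vi /(cQ v vi); rewrite dotNl => ->; rewrite oppr0.
have frR := frame_map (intr : int -> R) fr.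
have emb_int y : int_vec y ->
    int_vec (pt (map_mx intr u) (map_mx intr N) 0 y : 'rV[R]_n.+1).
  by move=> yi; exact: (slice_int u N 0 yi).
rewrite cg_iterD -/k1 -/Q1 => Qx.
have cx : dot (map_mx intr c) x = 0 by apply/c1/(cg_iter_base Qx).
have Sx : cg_iter be (slice Q1 u N 0) (x *m map_mx intr M).
  by apply: (cg_iter_face (j := 0) fr pQ1 _ Qx cx) => y /c1 ->.
rewrite -(frame_ptK frR x) cx /pt scale0r add0r dot_mulmxr.
apply: (IH R (slice Q1 u N 0) (ipoly_slice u N 0 pQ1) _ _ _ _ _ Sx).
- rewrite /slice /pt scale0r mul0mx addr0; apply: cg_iter_int => // i.
  by rewrite mxE.
(* Balance passes to the slice because all integer points of [Q] lie in [c x = 0] and survive the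
   closures. *)
- move=> d dS y [yi Sy].
  have := bQ (d *m (map_mx intr M)^T) _ _ (conj (emb_int y yi) (cg_iter_base Sy)).
  rewrite (frame_dot_lift frR); apply=> p [pi Qp].
  rewrite -dot_mulmxr; apply: dS; split; first exact: int_vecM.
  by apply: (slice_proj fr); [exact: cg_iter_int | exact: cQ].
- move=> y yi Sy; rewrite -dot_mulmxr.
  have := hQ _ (emb_int y yi) (cg_iter_base Sy).
  by rewrite /pt scale0r add0r.
Qed.

(** * Integer translations and affine hulls *)

Section Translation.
Variables (R : realType) (n : nat) (z : 'rV[int]_n).
Let zR : 'rV[R]_n := map_mx intr z.

Lemma ipoly_translate (Q : pset R n) : ipoly Q -> ipoly (fun x => Q (x + zR)).
Proof.
move=> [I [a [b Qab]]]; exists I, a, (fun i => b i - dot (map_mx intr (a i)) zR) => x.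
by rewrite Qab; split=> H i; have := H i; rewrite dotDr lerBrDr.
Qed.

Lemma cg_closure_translate (Q : pset R n) x :
  cg_closure Q (x + zR) -> cg_closure (fun x => Q (x + zR)) x.
Proof.
move=> [Qx cut]; split=> // c d ci cd.
have [m mE] : exists m : int, dot c zR = m%:~R.
  by move: ci => /int_vecP[v ->]; exists (dot v z); rewrite dot_map.
have := cut c (d + m%:~R) ci; rewrite -![dotv _ _]/(dot _ _) dotDr mE.
rewrite floorDrz ?intr_int // intrKfloor intrD lerD2r; apply=> y Qy.
by rewrite -lerBlDr -mE -dotBr; apply: cd; rewrite subrK.
Qed.

Lemma cg_iter_translate k (Q : pset R n) x :
  cg_iter k Q (x + zR) -> cg_iter k (fun x => Q (x + zR)) x.
Proof.
elim: k x => //= k IH x /cg_closure_translate.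
by apply: cg_closure_mono => y; exact: IH.
Qed.

End Translation.

(** A finite family in [T] of maximal rank spans [T], so the columns of its cokernel annihilate [T]
    and therefore [x]. *)
Lemma span_of_annihilator (F : fieldType) n (T : 'rV[F]_n -> Prop) (x : 'rV[F]_n) :
  (forall h, (forall p, T p -> dot h p = 0) -> dot h x = 0) ->
  exists m (V : 'M[F]_(m, n)), (forall i, T (row i V)) /\ (x <= V)%MS.
Proof.
move=> Tx; pose ranks r :=
  `[< exists m (V : 'M[F]_(m, n)), (forall i, T (row i V)) /\ \rank V = r >].
have ex : exists r, ranks r.
  by exists 0%N; apply/asboolP; exists 0%N, 0; split; [case | rewrite mxrank0].
have bd r : ranks r -> (r <= n)%N by move=> /asboolP[m [V [_ <-]]]; exact: rank_leq_col.
case: (ex_maxnP ex bd) => r /asboolP[m [V [TV rV]]] rmax.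
exists m, V; split=> //.
have TsubV p : T p -> (p <= V)%MS.
  move=> Tp; have : (\rank (col_mx V p) <= \rank V)%N.
    rewrite rV; apply: rmax; apply/asboolP; exists (m + 1)%N, (col_mx V p); split=> // i.
    have -> : row i (col_mx V p) = match split i with inl j => row j V | inr j => row j p end.
      apply/rowP=> k; rewrite mxE -{1}(splitK i); case: (split i) => j /=.
        by rewrite col_mxEu mxE.
      by rewrite col_mxEd mxE.
    by case: (split i) => j; [exact: TV | rewrite row_id].
  move=> le; have VS : (V <= col_mx V p)%MS by rewrite -addsmxE addsmxSl.
  apply: submx_trans (_ : col_mx V p <= V)%MS; first by rewrite -addsmxE addsmxSr.
  by rewrite -(geq_leqif (mxrank_leqif_sup VS)).
rewrite submxE; apply/eqP/rowP=> j; rewrite [RHS]mxE.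
have hE y : (y *m cokermx V) 0 j = dot (col j (cokermx V))^T y.
  by rewrite mxE; apply: eq_bigr => i _; rewrite !mxE mulrC.
rewrite hE; apply: Tx => p /TsubV; rewrite -hE submxE => /eqP ->.
by rewrite mxE.
Qed.

(** Seen from [z], an affine set is a linear space: multiples come from lines through [z], and a sum
    is twice a midpoint. *)
Lemma affine_set_sub (R : realType) n (A : pset R n) z m (V : 'M[R]_(m, n)) x :
  affine_set A -> A z -> (forall i, A (z + row i V)) -> (x <= V)%MS -> A (z + x).
Proof.
move=> affA Az AV.
have AZ t v : A (z + v) -> A (z + t *: v).
  move=> Av; have := affA _ _ t Az Av; rewrite scalerDr scalerBl scale1r addrA subrK.
  by [].
have AD v w : A (z + v) -> A (z + w) -> A (z + (v + w)).
  move=> Av Aw; have := AZ 2 _ _ : A (z + 2 *: (2^-1 *: (v + w))).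
  rewrite scalerA mulfV ?pnatr_eq0 // scale1r; apply.
  have := affA _ _ 2^-1 Av Aw; congr A.
  by apply/rowP=> k; rewrite !mxE; field.
move=> /submxP[D ->]; rewrite mulmx_sum_row.
elim/big_rec: _ => [|i y _ Ay]; first by rewrite addr0.
by apply: AD => //; apply: AZ.
Qed.

(** Through the integer hull, [d] is nonnegative on [P] seen from [z]. A small step from [z]
    opposite to [p] stays in [P], so [d] is also nonpositive at [p]. *)
Lemma relint_balanced (R : realType) n (P : pset R n) (z : 'rV[R]_n) :
  int_vec z -> relint P z -> (forall x, P x -> int_hull P x) ->
  balanced (fun x => int_vec x /\ P (x + z)).
Proof.
move=> zi [Pz [eps [eps0 near]]] hull d dP p [pi Pp].
have dhull x : P x -> 0 <= dot d (x - z).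
  move=> /hull[k [w [q [w0 [w1 [qP ->]]]]]].
  have -> : \sum_(i < k) w i *: q i - z = \sum_(i < k) w i *: (q i - z).
    by rewrite (eq_bigr _ (fun i _ => scalerBr _ _ _)) sumrB -scaler_suml w1 scale1r.
  rewrite dotC dot_suml sumr_ge0 // => i _; rewrite dotZl mulr_ge0 // dotC.
  apply: dP; rewrite subrK; have [Pq qi] := qP i; split=> // l.
  by rewrite !mxE rpredB.
(* [s] exceeds every coordinate of [p] in absolute value, so a step of [eps / s] stays within the
   [eps] box. *)
pose s := 1 + \sum_i `|p 0 i|.
have s0 : 0 < s by rewrite ltr_wpDr // sumr_ge0.
pose t := eps / s; have t0 : 0 < t by rewrite divr_gt0.
have : P (z - t *: p).
  apply: near => [A affA PA|i].
    have := affA _ _ (- t) (PA _ Pz) (PA _ Pp); congr A.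
    by apply/rowP=> k; rewrite !mxE; ring.
  rewrite !mxE addrAC subrr add0r normrN normrM gtr0_norm // /t mulrAC ltr_pdivrMr //.
  rewrite ltr_pM2l // /s (bigD1 i) //=.
  have : 0 <= \sum_(j | j != i) `|p 0 j| by apply: sumr_ge0.
  by lra.
move=> /dhull; rewrite addrAC subrr add0r dotNr dotZr oppr_ge0 pmulr_rle0 // => le0.
by apply/eqP; rewrite eq_le le0 dP.
Qed.

Theorem theorem1 :
  exists beta : nat -> nat,
    forall (R : realType) (n : nat), (0 < n)%N ->
    forall P : pset R n, integral_polyhedron P ->
    (exists z, int_vec z /\ relint P z) ->
    forall Q : pset R n, relaxation P Q ->
    forall x, cg_iter (beta n) Q x -> aff P x.
Proof.
have [beta betaP] := choice balanced_rank.
exists beta => R n _ P [_ hull] [z [zi zrel]] Q [ratQ QP] x Qx A affA PA.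
have Pz : P z by case: zrel.
have PQ y : int_vec y -> Q (y + z) <-> P (y + z).
  by move=> yi; apply: QP; exact: int_vecD.
move: (zi) => /int_vecP[v vE].
have pQ : ipoly (fun x => Q (x + z)).
  by rewrite vE; apply/ipoly_translate/rational_ipoly.
(* With [z] moved to the origin, [x - z] must lie in the span of the integer points of [P]; dually,
   each [h] vanishing on them must vanish at [x - z], which [balanced_rank] provides. *)
have [|m [V [VP xV]]] := @span_of_annihilator _ n (fun y => int_vec y /\ P (y + z)) (x - z).
  move=> h hP; apply: (betaP n R (fun x => Q (x + z)) pQ _ _ h).
  - by rewrite add0r; apply/QP.
  - move=> d dQ p [pi /(PQ p pi) Pp].
    have := relint_balanced zi zrel (fun y => proj1 (hull y)).
    apply; last by split.
    by move=> q [qi /(PQ q qi) Qq]; apply: dQ.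
  - by move=> p pi /(PQ p pi) Pp; apply: hP.
  - by move: Qx; rewrite -{1}(subrK z x) vE => /cg_iter_translate.
rewrite -(subrK z x) addrC; apply: (affine_set_sub affA (PA _ Pz) _ xV) => i.
by have [_] := VP i; rewrite addrC => /PA.
Qed.
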